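(* Let $\mu$ be a distribution on $\{0,1\}^n$ and let $\Phi$ be a family of convex functions $\varphi:\Delta_L\to\mathbb R$, each with a fixed choice of subgradient $\nabla\varphi(v)$ at every $v\in\Delta_L$. For every $\varepsilon,\delta\in(0,1/2)$ there exist $\delta'=\Omega(\delta\varepsilon^2/\log L)$ and an algorithm $\mathcal S$ such that for every $g^*:\{0,1\}^n\to\Delta_L$ and all oracles $\mathcal A,\mathcal B$: (1) if $\mathcal A$ is an $(m,T)$-distinguishing oracle and $\mathcal B$ an $(m,T)$-calibration oracle, then $\mathcal S$ takes $\mathrm{poly}(m,\log L,1/\varepsilon,\log(1/\delta))$ i.i.d.\ data points from $\mu_{g^*}$, uses $\mathcal A,\mathcal B$ as oracles, and returns $s:\{0,1\}^n\to\Delta_L$ in time $\mathrm{poly}(m,T,L,1/\varepsilon,\log(1/\delta))$, and $s(x)$ can be evaluated in time $\mathrm{poly}(m,T,L,1/\varepsilon,\log(1/\delta))$ for every $x$; (2) if in addition $\mathcal B$ is a $(\{\nabla\varphi\}_{\varphi\in\Phi},\varepsilon_1,\varepsilon,\delta')$-weak agnostic calibration oracle for some $\varepsilon_1>0$, then with probability at least $1-\delta$ over the draw of the input data, $s$ is $(\mathcal A,\varepsilon,\delta')$-indistinguishable from $g^*$ and $$\mathsf H_\varphi(s)-\mathsf H_\varphi(g^* )\ge\mathsf D_\varphi(g^*\|s)-\varepsilon_1\quad\text{for every }\varphi\in\Phi.$$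
   Context: $\Delta_L$ is the set of probability distributions on $[L]$. $\mathsf H_\varphi(g):=-\mathbb E_{x\sim\mu}[\varphi(g(x))]$ and $\mathsf D_\varphi(g^*\|g):=\mathbb E_{x\sim\mu}[\varphi(g^*(x))-\varphi(g(x))-\langle g^*(x)-g(x),\nabla\varphi(g(x))\rangle]$. For $g,h:\{0,1\}^n\to\mathbb R^L$, $\langle g,h\rangle:=\mathbb E_{x\sim\mu}\langle g(x),h(x)\rangle$. $\mu_g$: distribution of $(x,y)$ with $x\sim\mu$, $y\sim g(x)$; $\mu_{g,g^*}$: distribution of $(x,y,y^* )$ with $x\sim\mu$ then independently $y\sim g(x)$, $y^*\sim g^*(x)$. An $(m,T)$-distinguishing oracle is a time-$T$ algorithm taking $m$ points in $\{0,1\}^n\times[L]\times[L]$ and outputting $f:\{0,1\}^n\to[-1,1]^L$ evaluable in time $T$; an $(m,T)$-calibration oracle is a time-$T$ algorithm taking $m$ points in $\Delta_L\times[L]\times[L]$ and outputting $r:\Delta_L\to[-1,1]^L$ evaluable in time $T$. $g$ is $(\mathcal A,\varepsilon,\delta)$-distinguishable from $g^*$ if with probability $\ge1-\delta$ over $m$ i.i.d.\ draws from $\mu_{g,g^*}$ given to $\mathcal A$, its output $f$ has $\langle g-g^*,f\rangle>\varepsilon$; otherwise $(\mathcal A,\varepsilon,\delta)$-indistinguishable. For a family $\mathcal R$ of functions $\Delta_L\to\mathbb R^L$, an $(m,T)$-calibration oracle $\mathcal B$ is an $(\mathcal R,\varepsilon_1,\varepsilon,\delta)$-weak agnostic calibration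 oracle if for every $g,g^*:\{0,1\}^n\to\Delta_L$ such that some $r\in\mathcal R$ has $\langle g-g^*,r\circ g\rangle>\varepsilon_1$, with probability $\ge1-\delta$ over $m$ i.i.d.\ draws $(x_i,y_i,y_i^* )\sim\mu_{g,g^*}$, given $(g(x_i),y_i,y_i^* )$ as input, $\mathcal B$ outputs $r_{\mathrm{out}}$ with $\langle g-g^*,r_{\mathrm{out}}\circ g\rangle>\varepsilon$. *)

(* Defs.v *)
From mathcomp Require Import all_boot all_order all_algebra.
From mathcomp Require Import boolp classical_sets reals exp.

Set Implicit Arguments.
Unset Strict Implicit.
Unset Printing Implicit Defensive.

Import Order.TTheory GRing.Theory Num.Theory.
Local Open Scope ring_scope.

(** * Finite distributions, iid samples, and the analytic notions *)

Definition is_dist (R : realType) (T : finType) (p : {ffun T -> R}) : bool :=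
  [forall t, 0 <= p t] && (\sum_t p t == 1).

Record dist (R : realType) (T : finType) := Dist {
  pmf :> {ffun T -> R};
  _ : is_dist pmf
}.

(* [L] is 'I_L (labels start at 0), and Delta_L is [simplex R L]. *)
Definition simplex (R : realType) (L : nat) : Type := dist R 'I_L.
Definition cube (n : nat) : finType := n.-tuple bool.
Definition vec (R : realType) (L : nat) := {ffun 'I_L -> R}.

Definition prob (R : realType) (T : finType) (p : T -> R) (E : T -> Prop) : R :=
  \sum_(t | `[< E t >]) p t.

Definition iid (R : realType) (T : finType) (m : nat) (p : T -> R)
    (d : m.-tuple T) : R :=
  \prod_(i < m) p (tnth d i).

Section Analytic.
Variables (R : realType) (n L : nat) (mu : dist R (cube n)).
Implicit Types g h : cube n -> simplex R L.

Definition dotv (u v : vec R L) : R := \sum_l u l * v l.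

Definition inner (g h : cube n -> vec R L) : R := \sum_x mu x * dotv (g x) (h x).

Definition gap g h (x : cube n) : vec R L := pmf (g x) - pmf (h x).

(* mu_g and mu_{g,h} *)
Definition joint g (z : cube n * 'I_L) : R := mu z.1 * g z.1 z.2.
Definition joint2 g h (z : cube n * 'I_L * 'I_L) : R :=
  mu z.1.1 * g z.1.1 z.1.2 * h z.1.1 z.2.

(* Convex combinations are taken pointwise because a simplex is a subtype and
   not a module: w is the combination t u + (1 - t) v. *)
Definition convex_on_simplex (phi : simplex R L -> R) : Prop :=
  forall (t : R) (u v w : simplex R L), 0 <= t <= 1 ->
    (forall l, w l = t * u l + (1 - t) * v l) ->
    phi w <= t * phi u + (1 - t) * phi v.

Definition subgradient_at (phi : simplex R L -> R) (v : simplex R L)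
    (q : vec R L) : Prop :=
  forall w : simplex R L, phi v + dotv (pmf w - pmf v) q <= phi w.

Definition entropy (phi : simplex R L -> R) g : R :=
  - \sum_x mu x * phi (g x).

Definition divergence (phi : simplex R L -> R) (grad : simplex R L -> vec R L)
    h g : R :=
  \sum_x mu x * (phi (h x) - phi (g x) - dotv (gap h g x) (grad (g x))).

Definition distinguishable (m : nat)
    (A : m.-tuple (cube n * 'I_L * 'I_L) -> cube n -> vec R L)
    (eps delta : R) g h : Prop :=
  1 - delta <= prob (iid (joint2 g h)) (fun d => eps < inner (gap g h) (A d)).

Definition indistinguishable (m : nat)
    (A : m.-tuple (cube n * 'I_L * 'I_L) -> cube n -> vec R L)
    (eps delta : R) g h : Prop :=
  ~ distinguishable A eps delta g h.

Definition weak_agnostic (m : nat)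
    (B : m.-tuple (simplex R L * 'I_L * 'I_L) -> simplex R L -> vec R L)
    (Rs : set (simplex R L -> vec R L)) (eps1 eps delta : R) : Prop :=
  forall g h,
    (exists2 r, Rs r & eps1 < inner (gap g h) (fun x => r (g x))) ->
    1 - delta <= prob (iid (joint2 g h)) (fun d : m.-tuple _ =>
      let r_out := B (map_tuple (fun z => (g z.1.1, z.1.2, z.2)) d) in
      eps < inner (gap g h) (fun x => r_out (g x))).

End Analytic.

(** * Algorithms: a randomized real-RAM with oracle instructions

   Memory consists of cells holding natural numbers, cells holding reals, a
   read-only list of input points, and handles for the functions obtained from
   the oracles.  Natural-number arithmetic is restricted to addition and
   truncated subtraction, so that the bit length of numbers stays linear in the
   time; there is no rounding of reals to numbers.  The time of a command counts the nodes of the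
   expressions that are evaluated.  Programs know a point only through its
   coordinates [RPoint] and through the oracles, and passing a point to an
   oracle is passing a pointer. *)

Inductive nexp :=
| NLit of nat
| NGet of nexp
| NAdd of nexp & nexp
| NSub of nexp & nexp.

Inductive rexp (R : Type) :=
| RLit of R
| RNat of nexp
| RGet of nexp
| RPoint of nexp & nexp
| RAdd of rexp R & rexp R
| RSub of rexp R & rexp R
| RMul of rexp R & rexp R
| RDiv of rexp R & rexp R.

Inductive bexp (R : Type) :=
| NLt of nexp & nexp
| RLt of rexp R & rexp R.

Inductive cmd (R : Type) :=
| Skip
| SetN of nexp & nexp
| SetR of nexp & rexp R
| Flip of nexp & rexp R
| Seq of cmd R & cmd R
| If of bexp R & cmd R & cmd R
| While of bexp R & cmd R
| CallA of nexp
| EvalA of nexp & nexp & nexp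
| CallB of nexp & nexp
| EvalB of nexp & nexp & nexp.
Arguments Skip {R}.
Arguments SetN {R}.
Arguments CallA {R}.
Arguments EvalA {R}.
Arguments CallB {R}.
Arguments EvalB {R}.
Arguments NLt {R}.
Arguments RNat {R}.
Arguments RGet {R}.
Arguments RPoint {R}.

(* An algorithm that outputs a function: [learn] turns the input into a memory
   state, which represents the function, and [apply] evaluates it at a point. *)
Record procedure (R : Type) := Procedure { learn : cmd R; apply : cmd R }.

Fixpoint nsize (e : nexp) : nat :=
  match e with
  | NLit _ => 1
  | NGet a => (nsize a).+1
  | NAdd a b | NSub a b => (nsize a + nsize b).+1
  end.

Fixpoint rsize (R : Type) (e : rexp R) : nat :=
  match e with
  | RLit _ => 1
  | RNat a | RGet a => (nsize a).+1
  | RPoint a b => (nsize a + nsize b).+1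
  | RAdd a b | RSub a b | RMul a b | RDiv a b => (rsize a + rsize b).+1
  end.

Definition bsize (R : Type) (e : bexp R) : nat :=
  match e with
  | NLt a b => (nsize a + nsize b).+1
  | RLt a b => (rsize a + rsize b).+1
  end.

(* Outcome of a randomized computation: [Toss p t1 t0] continues as [t1] with
   probability p and as [t0] with probability 1 - p. *)
Inductive rand (R A : Type) :=
| Ret of A
| Toss of R & rand R A & rand R A.
Arguments Ret {R A}.

Fixpoint rbind (R A B : Type) (t : rand R A) (k : A -> rand R B) : rand R B :=
  match t with
  | Ret a => k a
  | Toss p t1 t0 => Toss p (rbind t1 k) (rbind t0 k)
  end.

Fixpoint on_leaves (R A : Type) (t : rand R A) (Q : A -> Prop) : Prop :=
  match t with
  | Ret a => Q a
  | Toss _ t1 t0 => on_leaves t1 Q /\ on_leaves t0 Q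
  end.

Fixpoint is_leaf (R A : Type) (t : rand R A) (a : A) : Prop :=
  match t with
  | Ret b => b = a
  | Toss _ t1 t0 => is_leaf t1 a \/ is_leaf t0 a
  end.

Fixpoint rprob (R : realType) (A : Type) (t : rand R A) (Q : A -> Prop) : R :=
  match t with
  | Ret a => `[< Q a >]%:R
  | Toss p t1 t0 => p * rprob t1 Q + (1 - p) * rprob t0 Q
  end.

Definition upd (V : Type) (f : nat -> V) (a : nat) (v : V) : nat -> V :=
  fun i => if i == a then v else f i.

Section Machine.
Variables (R : realType) (L : nat) (P : Type) (coord : P -> nat -> R).

Record state := State {
  nmem : nat -> nat;
  rmem : nat -> R;
  points : seq P;
  funsA : seq (P -> vec R L);
  funsB : seq (simplex R L -> vec R L);
  clock : nat
}.

(* [or_time] is charged for every oracle call and for every evaluation of a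
   function output by an oracle. *)
Record oracles := Oracles {
  or_m : nat;
  or_time : nat;
  or_A : or_m.-tuple (P * 'I_L * 'I_L) -> P -> vec R L;
  or_B : or_m.-tuple (simplex R L * 'I_L * 'I_L) -> simplex R L -> vec R L
}.

Definition start (ns : seq nat) (xs : seq P) : state :=
  State (nth 0%N ns) (fun=> 0) xs [::] [::] 0.

Definition present (x : P) (s : state) : state :=
  State (nmem s) (rmem s) (rcons (points s) x) (funsA s) (funsB s) 0.

Definition tick (w : nat) (s : state) : state :=
  State (nmem s) (rmem s) (points s) (funsA s) (funsB s) (clock s + w).

Definition set_nmem (f : nat -> nat) (s : state) : state :=
  State f (rmem s) (points s) (funsA s) (funsB s) (clock s).

Definition set_rmem (f : nat -> R) (s : state) : state :=
  State (nmem s) f (points s) (funsA s) (funsB s) (clock s).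

Definition push_funA (f : P -> vec R L) (s : state) : state :=
  State (nmem s) (rmem s) (points s) (rcons (funsA s) f) (funsB s) (clock s).

Definition push_funB (r : simplex R L -> vec R L) (s : state) : state :=
  State (nmem s) (rmem s) (points s) (funsA s) (rcons (funsB s) r) (clock s).

Definition store_vec (f : nat -> R) (a : nat) (v : vec R L) : nat -> R :=
  fun i => if (a <= i)%N
           then if insub (i - a)%N is Some l then v l else f i
           else f i.

Fixpoint neval (s : state) (e : nexp) : nat :=
  match e with
  | NLit k => k
  | NGet a => nmem s (neval s a)
  | NAdd a b => (neval s a + neval s b)%N
  | NSub a b => (neval s a - neval s b)%N
  end.

Fixpoint reval (s : state) (e : rexp R) : R :=
  match e with
  | RLit c => c
  | RNat a => (neval s a)%:R
  | RGet a => rmem s (neval s a)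
  | RPoint j i =>
      if onth (points s) (neval s j) is Some x then coord x (neval s i) else 0
  | RAdd a b => reval s a + reval s b
  | RSub a b => reval s a - reval s b
  | RMul a b => reval s a * reval s b
  | RDiv a b => reval s a / reval s b
  end.

Definition beval (s : state) (e : bexp R) : bool :=
  match e with
  | NLt a b => (neval s a < neval s b)%N
  | RLt a b => reval s a < reval s b
  end.

(* [exec O c s t]: the command c, run from s, halts on all outcomes of its coin
   tosses and has outcome t.  There is no derivation, that is, the run is not
   accepted, if c diverges, tosses a coin whose bias is not in [0, 1], or
   misuses the oracles (or uses them when O is None).
   - [CallA a]: the m triples (pointer to a point, y, y') are in the number
     cells from a on; the output of the oracle becomes a new handle.
   - [EvalA k j a]: store f(x), f of handle k and x the point j, in the L real
     cells from a on.
   - [CallB a b]: the m points of the simplex are in the real cells from a on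
     (L cells each) and the m pairs (y, y') are in the number cells from b on.
   - [EvalB k a b]: store r(v), r of handle k and v the point of the simplex in
     the real cells from a on, in the L real cells from b on. *)
Inductive exec (O : option oracles) : cmd R -> state -> rand R state -> Prop :=
| exec_skip s :
    exec O Skip s (Ret (tick 1 s))
| exec_setN a e s :
    exec O (SetN a e) s
      (Ret (tick (nsize a + nsize e).+1
              (set_nmem (upd (nmem s) (neval s a) (neval s e)) s)))
| exec_setR a e s :
    exec O (SetR a e) s
      (Ret (tick (nsize a + rsize e).+1
              (set_rmem (upd (rmem s) (neval s a) (reval s e)) s)))
| exec_flip a e s :
    0 <= reval s e <= 1 ->
    exec O (Flip a e) s
      (let out (b : bool) := Ret (tick (nsize a + rsize e).+1
         (set_nmem (upd (nmem s) (neval s a) b) s)) in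
       Toss (reval s e) (out true) (out false))
| exec_seq c1 c2 s t k :
    exec O c1 s t ->
    (forall s', is_leaf t s' -> exec O c2 s' (k s')) ->
    exec O (Seq c1 c2) s (rbind t k)
| exec_if b c1 c0 s t :
    exec O (if beval s b then c1 else c0) (tick (bsize b).+1 s) t ->
    exec O (If b c1 c0) s t
| exec_while_stop b c s :
    ~~ beval s b ->
    exec O (While b c) s (Ret (tick (bsize b).+1 s))
| exec_while_loop b c s t :
    beval s b ->
    exec O (Seq c (While b c)) (tick (bsize b).+1 s) t ->
    exec O (While b c) s t
| exec_callA E a s (d : (or_m E).-tuple (P * 'I_L * 'I_L)) :
    O = Some E ->
    (forall i : 'I_(or_m E),
       let p := (neval s a + 3 * i)%N in
       [/\ onth (points s) (nmem s p) = Some (tnth d i).1.1,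
           nmem s p.+1 = (tnth d i).1.2
         & nmem s p.+2 = (tnth d i).2]) ->
    exec O (CallA a) s
      (Ret (tick (nsize a + or_m E + or_time E).+1 (push_funA (or_A d) s)))
| exec_evalA E k j a s f x :
    O = Some E ->
    onth (funsA s) (neval s k) = Some f ->
    onth (points s) (neval s j) = Some x ->
    exec O (EvalA k j a) s
      (Ret (tick (nsize k + nsize j + nsize a + L + or_time E).+1
              (set_rmem (store_vec (rmem s) (neval s a) (f x)) s)))
| exec_callB E a b s (d : (or_m E).-tuple (simplex R L * 'I_L * 'I_L)) :
    O = Some E ->
    (forall i : 'I_(or_m E),
       let p := (neval s a + L * i)%N in
       let q := (neval s b + 2 * i)%N in
       [/\ forall l : 'I_L, rmem s (p + l)%N = (tnth d i).1.1 l,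
           nmem s q = (tnth d i).1.2
         & nmem s q.+1 = (tnth d i).2]) ->
    exec O (CallB a b) s
      (Ret (tick (nsize a + nsize b + or_m E * L + or_time E).+1
              (push_funB (or_B d) s)))
| exec_evalB E k a b s r (v : simplex R L) :
    O = Some E ->
    onth (funsB s) (neval s k) = Some r ->
    (forall l : 'I_L, rmem s (neval s a + l)%N = v l) ->
    exec O (EvalB k a b) s
      (Ret (tick (nsize k + nsize a + nsize b + L + or_time E).+1
              (set_rmem (store_vec (rmem s) (neval s b) (r v)) s))).

(* In the state s, [apply] computes F without coin tosses, each value in time
   at most b; the argument is appended to the list of points and the value is
   read in the first L real cells. *)
Definition evaluates (O : option oracles) (c : procedure R) (s : state)
    (F : P -> vec R L) (b : R) : Prop :=
  forall x, exists s',
    [/\ exec O (apply c) (present x s) (Ret s'),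
        forall l : 'I_L, rmem s' l = F x l
      & (clock s')%:R <= b].

(* F is a deterministic oracle-free time-T algorithm that takes m triples and
   outputs a function evaluable in time T. *)
Definition computable_in_time (m T : nat)
    (F : m.-tuple (P * 'I_L * 'I_L) -> P -> vec R L) : Prop :=
  exists c : procedure R, forall d : m.-tuple (P * 'I_L * 'I_L), exists s,
    [/\ exec None (learn c)
          (start (flatten [seq [:: val z.1.2; val z.2] | z <- d])
                 [seq z.1.1 | z <- d]) (Ret s),
        (clock s <= T)%N
      & evaluates None c s (F d) T%:R].

End Machine.

Definition cube_coord (R : realType) (n : nat) (x : cube n) (i : nat) : R :=
  (nth false x i)%:R.

Definition simplex_coord (R : realType) (L : nat) (v : simplex R L) (i : nat) : R :=
  if insub i is Some l then v l else 0.

Definition distinguishing_oracle (R : realType) (n L m T : nat)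
    (A : m.-tuple (cube n * 'I_L * 'I_L) -> cube n -> vec R L) : Prop :=
  (forall d x l, -1 <= A d x l <= 1) /\
  computable_in_time (@cube_coord R n) T A.

Definition calibration_oracle (R : realType) (L m T : nat)
    (B : m.-tuple (simplex R L * 'I_L * 'I_L) -> simplex R L -> vec R L) : Prop :=
  (forall d v l, -1 <= B d v l <= 1) /\
  computable_in_time (@simplex_coord R L) T B.

(* On nonnegative arguments these bounds dominate all polynomials. *)
Definition poly_bound (R : realType) (C k : nat) (a : seq R) : R :=
  C%:R * (1 + \sum_(x <- a) x) ^+ k.

(* The input of the algorithm that is given the data: m and the number N of data points in the number cells 0 and
   1, then the labels; the x-parts are the points 0, ..., N - 1. *)
Definition start_on_data (R : realType) (n L m N : nat)
    (data : N.-tuple (cube n * 'I_L)) : state R L (cube n) :=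
  start R L (m :: N :: [seq val z.2 | z <- data]) [seq z.1 | z <- data].
Arguments start_on_data R {n L} m {N} data.

(* Main.v *)
Require Import Defs.
From mathcomp Require Import all_boot all_order all_algebra.
From mathcomp Require Import boolp classical_sets reals sequences exp.
From mathcomp Require Import zify ring lra.

(* The learner starts from the uniform predictor and runs multiplicative weights.
   In each round both oracles are called on fresh samples, whose labels y are
   drawn from the current predictor s, and the inner products of s - gstar with
   their outputs are estimated on fresh data.  If one of them exceeds 3/4 eps,
   the predictor is updated in this direction; otherwise the learner stops.
   An update along a direction of inner product more than eps/2 decreases the
   cross entropy of s relative to gstar, which is at most ln L initially and never
   negative, by eps^2 / 32, so that there are O(log L / eps^2) updates.  If s is
   distinguishable from gstar or not calibrated, one of the oracles finds an inner
   product larger than eps with probability 1 - delta', so up to the Chernoff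
   error of the tests the learner only stops at a good s.  Calibration gives the
   entropy inequality, as H(s) - H(gstar) - D(gstar || s) = - <s - gstar, grad phi o s>. *)

Set Implicit Arguments.
Unset Strict Implicit.
Unset Printing Implicit Defensive.

Import Order.TTheory GRing.Theory Num.Theory.
Local Open Scope ring_scope.

(** * Probability *)

(** The obstacle is to connect the coin tosses of a concrete machine run with i.i.d. data. The
    interface is [success]: for fixed data, the probability over the drawn labels alone that the
    learner stops at a good history. For each data list, the program logic bounds the probability
    that the run ends well from below by [success]. What remains is the average of [success] over
    the data, a purely analytic statement proved by induction on the rounds. Each round consumes its
    own block of m + M points, so given the history the next block is still i.i.d. Pairs drawn with
    labels from gstar are enough to simulate triples, because the learner can evaluate s and draw y
    from s(x) itself. The number of rounds is so large that an update in every round would make the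
    cross entropy negative; a run without errors therefore stops on its own. *)

Section IidExpectation.
Variables (R : realType) (T : finType).
Implicit Types (p : T -> R) (F G : seq T -> R).

(** Peeling draws off a list, rather than summing over tuples, lets a sample be split into
    consecutive blocks without casts between tuple types. *)
Fixpoint iid_exp p (N : nat) F : R :=
  if N is N'.+1 then \sum_z p z * iid_exp p N' (fun d => F (z :: d)) else F [::].

Lemma iid_expE p N F :
  \sum_(d : N.-tuple T) iid p d * F d = iid_exp p N F.
Proof.
elim: N F => [|N IH] F /=.
  rewrite (big_pred1 [tuple]); last by move=> d; apply/esym/eqP; exact: tuple0.
  by rewrite /iid big_ord0 mul1r.
rewrite (reindex (fun u : T * N.-tuple T => cons_tuple u.1 u.2)) /=; last first.
  exists (fun d : N.+1.-tuple T => (thead d, behead_tuple d)).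
    by move=> [z d] _ /=; congr pair; apply: val_inj.
  by move=> d _ /=; rewrite [RHS]tuple_eta; apply: val_inj.
rewrite -(pair_bigA _ (fun z d => iid p (cons_tuple z d) * F (z :: d))) /=.
apply: eq_bigr => z _; rewrite -IH mulr_sumr; apply: eq_bigr => d _.
rewrite /iid big_ord_recl tnth0 mulrA; congr (_ * _ * _).
by apply: eq_bigr => i _; rewrite (tnth_nth z) /= -tnth_nth.
Qed.

Lemma eq_iid_exp p N F G :
  (forall d, size d = N -> F d = G d) -> iid_exp p N F = iid_exp p N G.
Proof.
elim: N F G => [|N IH] F G FG /=; first exact: FG.
by apply: eq_bigr => z _; congr (_ * _); apply: IH => d dN; apply: FG; rewrite /= dN.
Qed.

Lemma iid_exp_cat p a b F :
  iid_exp p (a + b) F =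
  iid_exp p a (fun d => iid_exp p b (fun d' => F (d ++ d'))).
Proof. by elim: a F => [|a IH] F //=; apply: eq_bigr => z _; rewrite IH. Qed.

Lemma iid_expD p N F G :
  iid_exp p N (fun d => F d + G d) = iid_exp p N F + iid_exp p N G.
Proof.
elim: N F G => [|N IH] F G //=.
by rewrite -big_split /=; apply: eq_bigr => z _; rewrite IH mulrDr.
Qed.

Lemma iid_expZ p N a F :
  iid_exp p N (fun d => a * F d) = a * iid_exp p N F.
Proof.
elim: N F => [|N IH] F //=; rewrite mulr_sumr.
by apply: eq_bigr => z _; rewrite IH mulrCA.
Qed.

Lemma iid_expN p N F : iid_exp p N (fun d => - F d) = - iid_exp p N F.
Proof.
rewrite -mulN1r -iid_expZ; apply: eq_iid_exp => d _.
by rewrite mulN1r.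
Qed.

Lemma iid_exp_prod p N (f : T -> R) :
  iid_exp p N (fun d => \prod_(z <- d) f z) = (\sum_z p z * f z) ^+ N.
Proof.
elim: N => [|N IH] /=; first by rewrite big_nil expr0.
rewrite exprS -IH mulr_suml; apply: eq_bigr => z _.
rewrite -mulrA; congr (_ * _); rewrite -iid_expZ.
by apply: eq_iid_exp => d _; rewrite big_cons.
Qed.

Variable p : T -> R.
Hypotheses (p_ge0 : forall z, 0 <= p z) (p_sum1 : \sum_z p z = 1).

Lemma le_iid_exp N F G :
  (forall d, size d = N -> F d <= G d) -> iid_exp p N F <= iid_exp p N G.
Proof.
elim: N F G => [|N IH] F G FG /=; first exact: FG.
apply: ler_sum => z _; apply: ler_wpM2l => //.
by apply: IH => d dN; apply: FG; rewrite /= dN.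
Qed.

Lemma iid_exp_const N a : iid_exp p N (fun=> a) = a.
Proof.
elim: N => [|N IH] //=.
by rewrite -[RHS]mul1r -p_sum1 mulr_suml; apply: eq_bigr => z _; rewrite IH.
Qed.

End IidExpectation.

Lemma prob_iidE (R : realType) (T : finType) (m : nat) (p : T -> R)
    (E : m.-tuple T -> Prop) (F : seq T -> R) :
  (forall d : m.-tuple T, F d = `[< E d >]%:R) ->
  prob (iid p) E = iid_exp p m F.
Proof.
move=> EF; rewrite -iid_expE /prob big_mkcond /=; apply: eq_bigr => d _.
by rewrite EF; case: ifP => _; rewrite ?mulr1 ?mulr0.
Qed.

(** * Exponential inequalities and the Chernoff bound *)

Section Elementary.
Variable R : realType.
Implicit Types x y : R.

(** From exp(-x) >= 1 - x one gets exp x <= 1 / (1 - x), and (1 - x) (1 + x + 2 x^2) = 1 + x^2 (1 -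
    2 x) >= 1. *)
Lemma expR_le_quadratic x : x <= 1 / 2 -> expR x <= 1 + x + 2 * x ^+ 2.
Proof.
move=> x_le; have x1 : 0 < 1 - x by lra.
have h := expR_ge1Dx (- x); have e0 := expR_gt0 x.
have eV : expR (- x) * expR x = 1 by rewrite -expRD addNr expR0.
have : (1 - x) * expR x <= 1 by rewrite -[leRHS]eV ler_pM2r.
move=> h1; rewrite -(ler_pM2l x1); apply: (le_trans h1).
have : 0 <= x ^+ 2 * (1 - 2 * x) by apply: mulr_ge0; [exact: sqr_ge0|lra].
have -> : (1 - x) * (1 + x + 2 * x ^+ 2) = 1 + x ^+ 2 * (1 - 2 * x) by ring.
by lra.
Qed.

(** The same polynomial identity gives 1 / (1 - x) <= 1 + y <= exp y for y = x + 2 x^2. *)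
Lemma ln_1B_ge x : x <= 1 / 2 -> - (x + 2 * x ^+ 2) <= ln (1 - x).
Proof.
move=> x_le; have x1 : 0 < 1 - x by lra.
set y := x + 2 * x ^+ 2.
have sq : 0 <= x ^+ 2 * (1 - 2 * x) by apply: mulr_ge0; [exact: sqr_ge0|lra].
have h : 1 <= (1 - x) * (1 + y).
  have -> : (1 - x) * (1 + y) = 1 + x ^+ 2 * (1 - 2 * x) by rewrite /y; ring.
  by lra.
rewrite -ler_expR lnK ?posrE //.
have eV : expR (- y) * expR y = 1 by rewrite -expRD addNr expR0.
rewrite -(ler_pM2r (expR_gt0 y)) eV (le_trans h) // ler_pM2l //.
exact: expR_ge1Dx.
Qed.

Lemma ln_le_sub1 x : 0 < x -> ln x <= x - 1.
Proof.
by move=> x0; have := expR_ge1Dx (ln x); rewrite lnK ?posrE //; lra.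
Qed.

End Elementary.

Section Tail.
Variables (R : realType) (T : finType) (p : T -> R).
Hypotheses (p_ge0 : forall z, 0 <= p z) (p_sum1 : \sum_z p z = 1).

(** As lam X <= 1/2, exp(lam X) <= 1 + lam X + 2 lam^2 X^2, and X^2 <= 4. The average of this bound
    is 1 + u with u the claimed exponent, and 1 + u <= exp u. *)
Lemma mgf_le (X : T -> R) (lam : R) :
  (forall z, -2 <= X z <= 2) -> 0 <= lam <= 1 / 4 ->
  \sum_z p z * expR (lam * X z) <=
    expR (lam * (\sum_z p z * X z) + 8 * lam ^+ 2).
Proof.
move=> X2 /andP[lam0 lam4]; apply: le_trans (expR_ge1Dx _).
have -> : 1 + (lam * (\sum_z p z * X z) + 8 * lam ^+ 2) =
  \sum_z p z * (1 + lam * X z + 8 * lam ^+ 2).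
  transitivity (\sum_z (p z + lam * (p z * X z) + p z * (8 * lam ^+ 2))).
    by rewrite !big_split /= -mulr_sumr -mulr_suml p_sum1 mul1r addrA.
  by apply: eq_bigr => z _; ring.
apply: ler_sum => z _; apply: ler_wpM2l => //.
have /andP[Xm XM] := X2 z.
have x_le : lam * X z <= 1 / 2 by nra.
apply: (le_trans (expR_le_quadratic x_le)).
have : X z ^+ 2 <= 4 by rewrite -subr_ge0 (_ : _ - _ = (2 - X z) * (2 + X z)); [apply: mulr_ge0; lra|ring].
move=> X4; have l2 : 0 <= lam ^+ 2 by exact: sqr_ge0.
have : lam ^+ 2 * X z ^+ 2 <= lam ^+ 2 * 4 by exact: ler_wpM2l.
by rewrite exprMn; lra.
Qed.

(* Chernoff bound with the exponential weight [eps / 64]. *)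
Lemma tail_bound (X : T -> R) (M : nat) (a eps : R) :
  (forall z, -2 <= X z <= 2) -> 0 < eps <= 1 ->
  \sum_z p z * X z <= a - eps / 4 ->
  iid_exp p M (fun d => (M%:R * a <= \sum_(z <- d) X z)%R%:R) <=
    expR (- (M%:R * eps ^+ 2 / 512)).
Proof.
move=> X2 /andP[eps0 eps1] mean; set lam := eps / 64.
have lam_bd : 0 <= lam <= 1 / 4 by rewrite /lam; apply/andP; split; lra.
have lam0 : 0 <= lam by case/andP: lam_bd.
(* Markov's inequality, pointwise: the indicator of u >= 0 is at most exp(lam u). *)
apply: le_trans (_ : iid_exp p M (fun d => expR (- (lam * (M%:R * a))) *
   \prod_(z <- d) expR (lam * X z)) <= _).
  apply: le_iid_exp => // d dM.
  rewrite -expR_sum.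
  rewrite -expRD -mulr_sumr addrC -mulrBr.
  case: (leP (M%:R * a)) => h; last by rewrite expR_ge0.
  apply: le_trans (expR_ge1Dx _); rewrite lerDl.
  by apply: mulr_ge0 => //; rewrite subr_ge0.
rewrite iid_expZ iid_exp_prod.
apply: le_trans (_ : expR (- (lam * (M%:R * a))) *
   expR (lam * (a - eps / 4) + 8 * lam ^+ 2) ^+ M <= _).
  apply: ler_wpM2l; first exact: expR_ge0.
  apply: lerXn2r; rewrite ?nnegrE.
  - by apply: sumr_ge0 => z _; apply: mulr_ge0 => //; exact: expR_ge0.
  - exact: expR_ge0.
  - apply: (le_trans (mgf_le X2 lam_bd)).
    by rewrite ler_expR lerD2r; exact: ler_wpM2l.
(* Per draw the exponent is - lam eps / 4 + 8 lam^2, which [eps / 64] minimises, with value - eps^2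
   / 512. *)
rewrite -expRM_natl -expRD ler_expR /lam.
by rewrite le_eqVlt; apply/orP; left; apply/eqP; field.
Qed.

End Tail.

(** * The learner *)

Section Simplex.
Variables (R : realType) (T : finType).
Implicit Types v : dist R T.

Lemma pmf_ge0 v t : 0 <= v t.
Proof. by case: v => f /= /andP[/forallP f0 _]. Qed.

Lemma pmf_sum1 v : \sum_t v t = 1.
Proof. by case: v => f /= /andP[_ /eqP]. Qed.

Lemma sum_pmf_le v (F : T -> R) a : (forall t, F t <= a) -> \sum_t v t * F t <= a.
Proof.
move=> Fa; rewrite -[leRHS]mul1r -(pmf_sum1 v) mulr_suml.
by apply: ler_sum => t _; apply: ler_wpM2l; rewrite ?pmf_ge0.
Qed.

Lemma sum_pmf_ge v (F : T -> R) a : (forall t, a <= F t) -> a <= \sum_t v t * F t.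
Proof.
move=> Fa; rewrite -[leLHS]mul1r -(pmf_sum1 v) mulr_suml.
by apply: ler_sum => t _; apply: ler_wpM2l; rewrite ?pmf_ge0.
Qed.

(* The junk value v is returned when f is not a distribution. *)
Definition to_dist (f : {ffun T -> R}) v : dist R T :=
  if @idP (is_dist f) is ReflectT fP then Dist fP else v.

Lemma to_distE f v : is_dist f -> pmf (to_dist f v) = f.
Proof. by rewrite /to_dist; case: {-}_ / idP. Qed.

End Simplex.

(** * Multiplicative weights and the cross-entropy potential *)

Section MultiplicativeWeights.
Variables (R : realType) (L : nat).
Implicit Types (u v w : simplex R L) (q : vec R L).

Definition bounded q := forall l, -1 <= q l <= 1.

(** Keeps the cross entropy away from the default value ln 0 = 0, and the divisors of the label
    sampler away from 0. *)
Definition positive v := forall l, 0 < v l.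

Lemma uniform_subproof (l0 : 'I_L) : is_dist [ffun l : 'I_L => (L%:R : R)^-1].
Proof.
apply/andP; split; first by apply/forallP => l; rewrite ffunE invr_ge0.
under eq_bigr => l _ do rewrite ffunE.
rewrite sumr_const card_ord -[_ *+ _]mulr_natr mulVf // pnatr_eq0.
by case: L l0 => // -[].
Qed.

Definition uniform (l0 : 'I_L) : simplex R L := Dist (uniform_subproof l0).

Lemma uniform_positive l0 : positive (uniform l0).
Proof. by move=> l; rewrite ffunE invr_gt0 ltr0n; case: L l0 l => // -[]. Qed.

Lemma dotv_bounded v q : bounded q -> -1 <= dotv v q <= 1.
Proof.
move=> qb; apply/andP; split.
  by apply: sum_pmf_ge => l; case/andP: (qb l).
by apply: sum_pmf_le => l; case/andP: (qb l).
Qed.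

Variable eta : R.

(* The linear update [1 - eta q] replaces [exp (- eta q)], because the machine
   only has field operations. *)
Definition mw v q : simplex R L :=
  to_dist [ffun l => v l * (1 - eta * q l) / (1 - eta * dotv v q)] v.

Hypothesis eta_itv : 0 < eta <= 1 / 2.

Lemma mul_eta_le a : -1 <= a <= 1 -> -(1 / 2) <= eta * a <= 1 / 2.
Proof. by case/andP: eta_itv => *; nra. Qed.

(** Both eta q(l) and eta <v, q> lie in [-1/2, 1/2], so factors and normaliser are positive and the
    default branch of [to_dist] is not taken. *)
Lemma mwE v q l : bounded q ->
  mw v q l = v l * (1 - eta * q l) / (1 - eta * dotv v q).
Proof.
move=> qb; rewrite /mw to_distE ?ffunE //.
have /andP[d1 d2] := mul_eta_le (dotv_bounded v qb).
apply/andP; split.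
  apply/forallP => k; rewrite ffunE; have /andP[q1 q2] := mul_eta_le (qb k).
  by apply: mulr_ge0; [apply: mulr_ge0; [exact: pmf_ge0|lra]|rewrite invr_ge0; lra].
under eq_bigr => k _ do rewrite ffunE.
rewrite -mulr_suml; apply/eqP.
have -> : \sum_k v k * (1 - eta * q k) = 1 - eta * dotv v q.
  rewrite -[X in X - _](pmf_sum1 v) /dotv mulr_sumr -sumrB.
  by apply: eq_bigr => k _; ring.
by rewrite mulfV //; apply/eqP; lra.
Qed.

Lemma mw_positive v q : bounded q -> positive v -> positive (mw v q).
Proof.
move=> qb vp l; rewrite mwE //.
have /andP[d1 d2] := mul_eta_le (dotv_bounded v qb).
have /andP[q1 q2] := mul_eta_le (qb l).
by apply: mulr_gt0; [apply: mulr_gt0; [exact: vp|lra]|rewrite invr_gt0; lra].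
Qed.

(** The relative entropy of w and v up to the entropy of w, which stays fixed during the run. It
    takes no logarithm of w, whose entries may vanish. *)
Definition cross_entropy w v : R := \sum_l w l * - ln (v l).

Lemma cross_entropy_ge0 w v : 0 <= cross_entropy w v.
Proof.
apply: sumr_ge0 => l _; apply: mulr_ge0; first exact: pmf_ge0.
rewrite oppr_ge0 ln_le0 //; rewrite -(pmf_sum1 v) (bigD1 l) //= lerDl.
by apply: sumr_ge0 => k _; exact: pmf_ge0.
Qed.

(** Per label, the change is - ln (1 - eta q(l)) + ln (1 - eta <v, q>). The first term is at most
    eta q(l) + 2 eta^2 by [ln_1B_ge], the second at most - eta <v, q>; then average over w. *)
Lemma cross_entropy_mw w v q : bounded q -> positive v ->
  cross_entropy w (mw v q) <=
  cross_entropy w v - eta * (dotv v q - dotv w q) + 2 * eta ^+ 2.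
Proof.
move=> qb vp; have /andP[d1 d2] := mul_eta_le (dotv_bounded v qb).
set D := dotv v q in d1 d2 *.
have -> : cross_entropy w v - eta * (D - dotv w q) + 2 * eta ^+ 2 =
   \sum_l w l * (- ln (v l) - eta * D + eta * q l + 2 * eta ^+ 2).
  transitivity (\sum_l (w l * - ln (v l) + w l * (2 * eta ^+ 2 - eta * D) +
      eta * (w l * q l))).
    rewrite !big_split /= -mulr_suml pmf_sum1 -mulr_sumr /cross_entropy /dotv.
    ring.
  by apply: eq_bigr => l _; ring.
apply: ler_sum => l _; apply: ler_wpM2l; first exact: pmf_ge0.
rewrite mwE //; have /andP[q1 q2] := mul_eta_le (qb l).
have a0 : 0 < 1 - eta * q l by lra.
have Z0 : 0 < 1 - eta * D by lra.
rewrite ln_div ?posrE ?mulr_gt0 // lnM ?posrE //.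
have h1 := ln_1B_ge q2; have h2 := ln_le_sub1 Z0.
have : (eta * q l) ^+ 2 <= eta ^+ 2.
  have /andP[b1 b2] := qb l.
  rewrite exprMn -[leRHS]mulr1; apply: ler_wpM2l; first exact: sqr_ge0.
  by rewrite -subr_ge0 (_ : _ - _ = (1 - q l) * (1 + q l)); [apply: mulr_ge0; lra|ring].
by move: h1 h2; rewrite -/D; lra.
Qed.

End MultiplicativeWeights.

Section Learner.
Variables (R : realType) (n L : nat) (l0 : 'I_L) (eta : R).
Local Notation P := (cube n).
Local Notation predictor := (P -> simplex R L).

(* Both oracles are called in every round, but only one of their outputs is used
   for the update, which is what [use_A] records. *)
Record round := Round {
  use_A : bool;
  out_A : P -> vec R L;
  out_B : simplex R L -> vec R L
}.

Definition update_fun (e : round) (x : P) (v : simplex R L) : vec R L :=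
  if use_A e then out_A e x else out_B e v.

Definition hypothesis_of (h : seq round) : predictor := fun x =>
  foldl (fun v e => mw eta v (update_fun e x v)) (uniform R l0) h.

Definition bounded_round (e : round) : Prop :=
  (forall x, bounded (out_A e x)) /\ (forall v, bounded (out_B e v)).

Lemma bounded_update e x v : bounded_round e -> bounded (update_fun e x v).
Proof. by rewrite /update_fun; case: (use_A e) => -[]. Qed.

Definition round0 : round := Round true (fun=> 0) (fun=> 0).

(** Stated by position rather than by membership, as rounds contain functions. *)
Definition bounded_rounds (h : seq round) : Prop :=
  forall i, (i < size h)%N -> bounded_round (nth round0 h i).

Lemma bounded_rounds_rcons h e :
  bounded_rounds h -> bounded_round e -> bounded_rounds (rcons h e).
Proof.
move=> hb eb i; rewrite size_rcons ltnS leq_eqVlt nth_rcons.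
by case: ltnP => [/hb//|_]; case: eqP.
Qed.

Lemma hypothesis_of_rcons h e x :
  hypothesis_of (rcons h e) x =
  mw eta (hypothesis_of h x) (update_fun e x (hypothesis_of h x)).
Proof. by rewrite /hypothesis_of foldl_rcons. Qed.

Hypothesis eta_itv : 0 < eta <= 1 / 2.

Lemma hypothesis_positive h x : bounded_rounds h -> positive (hypothesis_of h x).
Proof.
elim/last_ind: h => [|h e IH] hb; first exact: uniform_positive.
rewrite hypothesis_of_rcons; apply: mw_positive => //.
  apply: bounded_update; have := hb (size h).
  by rewrite size_rcons ltnSn nth_rcons ltnn eqxx; apply.
apply: IH => i ih; have := hb i; rewrite size_rcons ltnS nth_rcons ih.
by apply; exact: ltnW.
Qed.

Variables (mu : dist R P) (gs : predictor).

Definition potential (h : seq round) : R :=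
  \sum_x mu x * cross_entropy (gs x) (hypothesis_of h x).

Lemma potential_ge0 h : 0 <= potential h.
Proof.
by apply: sumr_ge0 => x _; apply: mulr_ge0; rewrite ?pmf_ge0 ?cross_entropy_ge0.
Qed.

Lemma potential_nil : potential [::] = ln L%:R.
Proof.
have L0 : (0 : R) < L%:R by rewrite ltr0n; case: L l0 => // -[].
rewrite /potential; transitivity (\sum_x mu x * ln L%:R).
  apply: eq_bigr => x _; congr (_ * _); rewrite /cross_entropy /=.
  under eq_bigr => l _ do rewrite ffunE lnV ?posrE // opprK.
  by rewrite -mulr_suml pmf_sum1 mul1r.
by rewrite -mulr_suml pmf_sum1 mul1r.
Qed.

Lemma dotvB (u v : simplex R L) q :
  dotv (pmf u - pmf v) q = dotv u q - dotv v q.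
Proof.
by rewrite /dotv -sumrB; apply: eq_bigr => l _; rewrite !ffunE mulrBl.
Qed.

Lemma potential_rcons h e : bounded_rounds h -> bounded_round e ->
  potential (rcons h e) <= potential h -
    eta * inner mu (gap (hypothesis_of h) gs)
      (fun x => update_fun e x (hypothesis_of h x)) + 2 * eta ^+ 2.
Proof.
move=> hb eb; set s := hypothesis_of h.
have -> : potential h - eta * inner mu (gap s gs)
      (fun x => update_fun e x (s x)) + 2 * eta ^+ 2 =
  \sum_x mu x * (cross_entropy (gs x) (s x) -
     eta * dotv (gap s gs x) (update_fun e x (s x)) + 2 * eta ^+ 2).
  transitivity (\sum_x (mu x * cross_entropy (gs x) (s x) +
     - eta * (mu x * dotv (gap s gs x) (update_fun e x (s x))) +
     mu x * (2 * eta ^+ 2))).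
    rewrite !big_split /= -mulr_suml pmf_sum1 mul1r -mulr_sumr /potential /inner.
    by rewrite mulNr.
  by apply: eq_bigr => x _; ring.
apply: ler_sum => x _; apply: ler_wpM2l; first exact: pmf_ge0.
rewrite hypothesis_of_rcons -/s /gap dotvB.
apply: cross_entropy_mw => //; first exact: bounded_update.
exact: hypothesis_positive.
Qed.

End Learner.

(** * Drawn labels and the statistical tests *)

Section DataDistribution.
Variables (R : realType) (n L : nat) (mu : dist R (cube n)).
Local Notation P := (cube n).
Local Notation predictor := (P -> simplex R L).
Implicit Types (s g : predictor) (D : seq (P * 'I_L)).

Lemma joint_ge0 g z : 0 <= joint mu g z.
Proof. by apply: mulr_ge0; exact: pmf_ge0. Qed.

Lemma sum_jointE g (F : P * 'I_L -> R) :
  \sum_z joint mu g z * F z = \sum_x mu x * \sum_y g x y * F (x, y).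
Proof.
rewrite (eq_bigr (fun z => joint mu g (z.1, z.2) * F (z.1, z.2))); last by case.
rewrite -(pair_bigA _ (fun x y => joint mu g (x, y) * F (x, y))) /=.
apply: eq_bigr => x _; rewrite mulr_sumr; apply: eq_bigr => y _.
by rewrite /joint mulrA.
Qed.

Lemma joint_sum1 g : \sum_z joint mu g z = 1.
Proof.
transitivity (\sum_z joint mu g z * 1); first by apply: eq_bigr => z _; rewrite mulr1.
rewrite sum_jointE -[RHS](pmf_sum1 mu); apply: eq_bigr => x _.
by rewrite -mulr_suml pmf_sum1 !mulr1.
Qed.

Lemma joint2_ge0 s g z : 0 <= joint2 mu s g z.
Proof. by apply: mulr_ge0; [apply: mulr_ge0|]; exact: pmf_ge0. Qed.

Lemma sum_joint2E s g (F : P * 'I_L * 'I_L -> R) :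
  \sum_z joint2 mu s g z * F z =
  \sum_z joint mu g z * \sum_y s z.1 y * F (z.1, y, z.2).
Proof.
rewrite sum_jointE (eq_bigr (fun z => joint2 mu s g (z.1, z.2) * F (z.1, z.2))); last by case.
rewrite -(pair_bigA _ (fun u y => joint2 mu s g (u, y) * F (u, y))) /=.
rewrite (eq_bigr (fun u => \sum_y joint2 mu s g (u.1, u.2, y) * F (u.1, u.2, y))); last by case.
rewrite -(pair_bigA _ (fun x y => \sum_y' joint2 mu s g (x, y, y') * F (x, y, y'))) /=.
apply: eq_bigr => x _; rewrite mulr_sumr exchange_big /=; apply: eq_bigr => y' _.
rewrite mulrA mulr_sumr; apply: eq_bigr => y _.
by rewrite /joint2 /=; ring.
Qed.

Lemma joint2_sum1 s g : \sum_z joint2 mu s g z = 1.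
Proof.
transitivity (\sum_z joint2 mu s g z * 1); first by apply: eq_bigr => z _; rewrite mulr1.
rewrite sum_joint2E -[RHS](joint_sum1 g); apply: eq_bigr => z _.
by rewrite -mulr_suml pmf_sum1 !mulr1.
Qed.

(* The average of F over independent labels y ~ s(x), one for each point of D. *)
Fixpoint label_exp s D (F : seq (P * 'I_L * 'I_L) -> R) : R :=
  if D is z :: D' then
    \sum_y s z.1 y * label_exp s D' (fun d => F ((z.1, y, z.2) :: d))
  else F [::].

Lemma iid_exp_sum (T I : finType) (p : T -> R) N (a : I -> R) (F : I -> seq T -> R) :
  iid_exp p N (fun d => \sum_i a i * F i d) = \sum_i a i * iid_exp p N (F i).
Proof.
elim: N F => [|N IH] F //=.
under eq_bigr => z _ do rewrite (IH (fun i d => F i (z :: d))) mulr_sumr.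
rewrite exchange_big /=; apply: eq_bigr => i _; rewrite mulr_sumr.
by apply: eq_bigr => z _; rewrite mulrCA.
Qed.

(** A finite Fubini: data that come later can be averaged inside the label draws of an earlier
    block. *)
Lemma iid_exp_label_exp (T : finType) (p : T -> R) N s D F :
  iid_exp p N (fun d' => label_exp s D (fun d => F d d')) =
  label_exp s D (fun d => iid_exp p N (F d)).
Proof.
elim: D F => [|z D IH] F //=.
rewrite (iid_exp_sum p N (s z.1) (fun y d' => label_exp s D (fun d => F ((z.1, y, z.2) :: d) d'))).
by apply: eq_bigr => y _; rewrite (IH (fun d => F ((z.1, y, z.2) :: d))).
Qed.

(** This is where data labelled by g alone become triples from mu_{s,g}, the distribution for which
    the oracles give guarantees. *)
Lemma joint_label_exp s g N F :
  iid_exp (joint mu g) N (fun D => label_exp s D F) =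
  iid_exp (joint2 mu s g) N F.
Proof.
elim: N F => [|N IH] F //=.
rewrite sum_joint2E; apply: eq_bigr => z _; congr (_ * _).
rewrite (iid_exp_sum _ N (s z.1) (fun y D => label_exp s D (fun d => F ((z.1, y, z.2) :: d)))).
by apply: eq_bigr => y _; rewrite IH.
Qed.

(** An unbiased one-point estimate of <s - g, f>: s is known, so its part is computed exactly, and
    only the part of g is sampled. *)
Definition score s (f : P -> vec R L) (z : P * 'I_L) : R :=
  dotv (s z.1) (f z.1) - f z.1 z.2.

Lemma score_mean s g f :
  \sum_z joint mu g z * score s f z = inner mu (gap s g) f.
Proof.
rewrite sum_jointE; apply: eq_bigr => x _; congr (_ * _); rewrite /gap dotvB.
rewrite /score /= (eq_bigr (fun y => g x y * dotv (s x) (f x) - g x y * f x y)).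
  by rewrite sumrB -mulr_suml pmf_sum1 mul1r.
by move=> y _; rewrite mulrBr.
Qed.

Lemma score_bounded s f z : (forall x, bounded (f x)) -> -2 <= score s f z <= 2.
Proof.
move=> fb; have /andP[d1 d2] := dotv_bounded (s z.1) (fb z.1).
by have /andP[f1 f2] := fb z.1 z.2; rewrite /score; apply/andP; split; lra.
Qed.

Section Threshold.
Variables (eps : R) (M : nat).
Hypothesis eps_itv : 0 < eps <= 1.

(** The cut at 3/4 eps is halfway between eps/2 and eps, which leaves the margin eps/4 of
    [tail_bound] on both sides. *)
Definition threshold : R := M%:R * (3 / 4 * eps).

(** Between eps/2 and eps neither answer counts as an error: an update there still makes progress,
    and stopping there is compatible with failed oracles. *)
Definition test_error s g f (D : seq (P * 'I_L)) : bool :=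
  (inner mu (gap s g) f <= eps / 2) && (threshold < \sum_(z <- D) score s f z) ||
  (eps < inner mu (gap s g) f) && (\sum_(z <- D) score s f z <= threshold).

Lemma test_error_le s g f : (forall x, bounded (f x)) ->
  iid_exp (joint mu g) M (fun D => (test_error s g f D)%:R) <=
    expR (- (M%:R * eps ^+ 2 / 512)).
Proof.
move=> fb; have j0 := joint_ge0 g; have j1 := joint_sum1 g.
case: (leP (inner mu (gap s g) f) (eps / 2)) => [low|high].
  apply: (le_trans _ (@tail_bound R _ _ j0 j1 (score s f) M (3 / 4 * eps) eps _ eps_itv _)).
  - have Nhigh : (eps < inner mu (gap s g) f) = false.
      by apply/negbTE; rewrite -leNgt (le_trans low) //; case/andP: eps_itv => *; lra.
    apply: le_iid_exp => // D _.
    rewrite ler_nat /test_error low Nhigh /threshold /= orbF.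
    by case: ltP => [/ltW ->|].
  - by move=> z; exact: score_bounded.
  - by rewrite score_mean; case/andP: eps_itv => *; lra.
have Nlow : (inner mu (gap s g) f <= eps / 2) = false by rewrite leNgt high.
case: (leP (inner mu (gap s g) f) eps) => [mid|{}high].
  apply: le_trans (expR_ge0 _); rewrite -[leRHS](iid_exp_const j1 M).
  by apply: le_iid_exp => // D _; rewrite /test_error Nlow /= ltNge mid.
(* A missed large inner product is an upper tail of the negated scores, whose mean is below - eps =
   - 3/4 eps - eps/4. *)
apply: (le_trans _ (@tail_bound R _ _ j0 j1 (fun z => - score s f z) M (- (3 / 4 * eps)) eps _ eps_itv _)).
- apply: le_iid_exp => // D _.
  rewrite ler_nat /test_error Nlow /threshold /= mulrN sumrN lerN2.
  by case: (_ <= M%:R * _); rewrite ?andbF // andbT leq_b1.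
- by move=> z; have /andP[s1 s2] := score_bounded s z fb; apply/andP; split; lra.
- rewrite (eq_bigr (fun z => - (joint mu g z * score s f z))).
    by rewrite sumrN score_mean; move: high; case/andP: eps_itv => *; lra.
  by move=> z _; rewrite mulrN.
Qed.

End Threshold.

End DataDistribution.

(** * Success probability of the abstract learner *)

Section Success.
Variables (R : realType) (n L : nat) (l0 : 'I_L) (eps : R).
Hypothesis eps_itv : 0 < eps <= 1.
Local Notation P := (cube n).
Local Notation predictor := (P -> simplex R L).
Variables (m M : nat).
Variable A : seq (P * 'I_L * 'I_L) -> P -> vec R L.
Variable B : seq (simplex R L * 'I_L * 'I_L) -> simplex R L -> vec R L.
Hypothesis A_bounded : forall d x, bounded (A d x).
Hypothesis B_bounded : forall d v, bounded (B d v).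

(** The minimiser of - eta eps / 2 + 2 eta^2, the guaranteed change of the potential; its value
    there is - eps^2 / 32. *)
Definition rate : R := eps / 8.

Local Notation hyp := (hypothesis_of l0 rate).

Lemma rate_itv : 0 < rate <= 1 / 2.
Proof. by rewrite /rate; case/andP: eps_itv => *; apply/andP; split; lra. Qed.

Definition relabel (s : predictor) (d : seq (P * 'I_L * 'I_L)) :=
  [seq (s z.1.1, z.1.2, z.2) | z <- d].

Definition play (h : seq (round R n L)) (b : bool) d : round R n L :=
  Round b (A d) (B (relabel (hyp h) d)).

Definition update_of (h : seq (round R n L)) (b : bool) d (x : P) : vec R L :=
  update_fun (play h b d) x (hyp h x).

Definition passes h b d (D : seq (P * 'I_L)) : bool :=
  threshold eps M < \sum_(z <- D) score (hyp h) (update_of h b d) z.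

Variable good : seq (round R n L) -> Prop.

(* The probability that the learner, with history h and j remaining rounds on
   the data D, stops at a good history. *)
Fixpoint success (j : nat) (h : seq (round R n L)) (D : seq (P * 'I_L)) : R :=
  if j is j'.+1 then
    label_exp (hyp h) (take m D) (fun d =>
      if passes h true d (take M (drop m D))
      then success j' (rcons h (play h true d)) (drop (m + M) D)
      else if passes h false d (take M (drop m D))
      then success j' (rcons h (play h false d)) (drop (m + M) D)
      else `[< good h >]%:R)
  else `[< good h >]%:R.

Variables (mu : dist R P) (gs : predictor).

Definition oracles_fail h d : bool :=
  (inner mu (gap (hyp h) gs) (update_of h true d) <= eps) &&
  (inner mu (gap (hyp h) gs) (update_of h false d) <= eps).

Variable delta' : R.
Hypothesis oracles_succeed : forall h, bounded_rounds h -> ~ good h ->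
  iid_exp (joint2 mu (hyp h) gs) m (fun d => (oracles_fail h d)%:R) <= delta'.

(** Union bound for one round: both oracles miss, or one of the two tests errs. *)
Definition failure_rate : R := delta' + 2 * expR (- (M%:R * eps ^+ 2 / 512)).

Hypothesis delta'_ge0 : 0 <= delta'.

Lemma bounded_play h b d : bounded_round (play h b d).
Proof. by split=> ? ; [exact: A_bounded|exact: B_bounded]. Qed.

Lemma potential_play h b d : bounded_rounds h ->
  eps / 2 < inner mu (gap (hyp h) gs) (update_of h b d) ->
  potential l0 rate mu gs (rcons h (play h b d)) <
    potential l0 rate mu gs h - eps ^+ 2 / 32.
Proof.
move=> hb gt_eps.
apply: (le_lt_trans (potential_rcons l0 rate_itv mu gs hb (bounded_play h b d))).
have rate0 : 0 < rate by case/andP: rate_itv.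
move: gt_eps; rewrite -(ltr_pM2l rate0) /update_of.
have -> : rate * (eps / 2) = eps ^+ 2 / 16 by rewrite /rate; field.
have -> : 2 * rate ^+ 2 = eps ^+ 2 / 32 by rewrite /rate; field.
by lra.
Qed.

Lemma label_exp_ge0 (s : predictor) D F :
  (forall d, 0 <= F d) -> 0 <= label_exp s D F.
Proof.
elim: D F => [|z D IH] F F0 /=; first exact: F0.
by apply: sumr_ge0 => y _; apply: mulr_ge0; [exact: pmf_ge0|exact: IH].
Qed.

Lemma success_ge0 j h D : 0 <= success j h D.
Proof.
elim: j h D => [|j IH] h D /=; first by case: asboolP.
apply: label_exp_ge0 => d; case: ifP => _; first exact: IH.
by case: ifP => _; [exact: IH|case: asboolP].
Qed.

(** Each remaining round pays for one [failure_rate] and for a potential drop of eps^2 / 32. An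
    update after a correct test preserves the bound on the potential for the remaining rounds, so
    the induction hypothesis applies to the rest. *)
Lemma success_ge j h : bounded_rounds h ->
  potential l0 rate mu gs h < j%:R * (eps ^+ 2 / 32) ->
  1 - j%:R * failure_rate <=
    iid_exp (joint mu gs) (j * (m + M)) (success j h).
Proof.
have j0 := joint_ge0 mu gs; have j1 := joint_sum1 mu gs.
have f0 : 0 <= failure_rate.
  by apply: addr_ge0 => //; apply: mulr_ge0 => //; exact: expR_ge0.
elim: j h => [|j IH] h hb pot.
  (* Without remaining rounds, the hypothesis would make the potential negative. *)
  by move: (potential_ge0 l0 rate mu gs h) pot; rewrite mul0r => /le_lt_trans h0 /h0; rewrite ltxx.
rewrite mulSn iid_exp_cat iid_exp_cat.
set J := joint mu gs; set s := hyp h.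
pose next d D' := iid_exp J (j * (m + M)) (fun D'' =>
      if passes h true d D'
      then success j (rcons h (play h true d)) D''
      else if passes h false d D'
      then success j (rcons h (play h false d)) D''
      else `[< good h >]%:R).
(* The three blocks are separated: training points with their labels become draws from [joint2],
   then come the test points, then the later data. *)
have -> : iid_exp J m (fun d1 => iid_exp J M (fun d2 =>
     iid_exp J (j * (m + M)) (fun d3 => success j.+1 h ((d1 ++ d2) ++ d3)))) =
   iid_exp (joint2 mu s gs) m (fun d => iid_exp J M (next d)).
  rewrite -joint_label_exp; apply: eq_iid_exp => d1 d1m.
  rewrite -iid_exp_label_exp; apply: eq_iid_exp => d2 d2M.
  rewrite -iid_exp_label_exp; apply: eq_iid_exp => d3 d3N /=.
  rewrite -catA take_size_cat // drop_size_cat // take_size_cat //.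
  by rewrite catA drop_size_cat // size_cat d1m d2M.
apply: le_trans (_ : iid_exp (joint2 mu s gs) m (fun d =>
   1 - j%:R * failure_rate - (~~ `[< good h >] && oracles_fail h d)%:R -
   2 * expR (- (M%:R * eps ^+ 2 / 512))) <= _); last first.
  apply: le_iid_exp; first exact: joint2_ge0.
  move=> d _.
  (* Replacing the tail bounds by the error indicators reduces the claim to fixed triples and fixed
     test points. *)
  apply: le_trans (_ : iid_exp J M (fun D' => 1 - j%:R * failure_rate -
     (~~ `[< good h >] && oracles_fail h d)%:R -
     ((test_error mu eps M s gs (update_of h true d) D')%:R +
      (test_error mu eps M s gs (update_of h false d) D')%:R)) <= _).
    rewrite iid_expD iid_exp_const // iid_expN iid_expD lerD2l lerN2.
    have ub b x : bounded (update_of h b d x) by apply: bounded_update; exact: bounded_play.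
    have := lerD (test_error_le mu M eps_itv s gs (ub true)) (test_error_le mu M eps_itv s gs (ub false)).
    by move/le_trans; apply; lra.
  apply: le_iid_exp => // D' _.
  have jf : 0 <= j%:R * failure_rate by exact: mulr_ge0.
  have step b : eps / 2 < inner mu (gap s gs) (update_of h b d) ->
      1 - j%:R * failure_rate <=
      iid_exp J (j * (m + M)) (success j (rcons h (play h b d))).
    move=> hi; apply: IH; first by apply: bounded_rounds_rcons => //; exact: bounded_play.
    apply: (lt_trans (potential_play hb hi)).
    by move: pot; rewrite -natr1; lra.
  have jge0 b : 0 <= iid_exp J (j * (m + M)) (success j (rcons h (play h b d))).
    rewrite -[leLHS](iid_exp_const j1 (j * (m + M))).
    by apply: le_iid_exp => // D'' _; exact: success_ge0.
  rewrite /next /oracles_fail -/s.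
  have err b : test_error mu eps M s gs (update_of h b d) D' =
      (inner mu (gap s gs) (update_of h b d) <= eps / 2) && passes h b d D' ||
      (eps < inner mu (gap s gs) (update_of h b d)) && ~~ passes h b d D'.
    by rewrite /test_error /passes -leNgt.
  have stepT := step true; have stepF := step false.
  have geT := jge0 true; have geF := jge0 false.
  (* If an error occurs, the left side is at most 0. A correct passed test leads to [step]. If both
     tests correctly reject, both inner products are at most eps, so h is good or the indicator of
     [oracles_fail] pays for it. *)
  rewrite !err.
  case: (passes h true d D') => /=.
    rewrite andbF orbF andbT; case: (leP _ (eps / 2)) stepT => [_ _|_ /(_ isT) st].
      by case: (_ && _); case: (_ || _) => /=; lra.
    by case: (_ && _); case: (_ || _) => /=; lra.
  rewrite andbF andbT /=; case: (passes h false d D') => /=.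
    rewrite andbF orbF andbT; case: (leP _ (eps / 2)) stepF => [_ _|_ /(_ isT) st].
      by case: (_ && _); case: (eps < _) => /=; lra.
    by case: (_ && _); case: (eps < _) => /=; lra.
  rewrite andbF andbT /= iid_exp_const // !ltNge.
  case: (inner mu (gap s gs) (update_of h true d) <= eps);
    by case: (_ <= eps); case: asboolP => _ /=; lra.
have -> : iid_exp (joint2 mu s gs) m (fun d =>
   1 - j%:R * failure_rate - (~~ `[< good h >] && oracles_fail h d)%:R -
   2 * expR (- (M%:R * eps ^+ 2 / 512))) =
   1 - j%:R * failure_rate -
   iid_exp (joint2 mu s gs) m (fun d => (~~ `[< good h >] && oracles_fail h d)%:R) -
   2 * expR (- (M%:R * eps ^+ 2 / 512)).
  by rewrite iid_expD iid_expD !iid_expN !(iid_exp_const (joint2_sum1 mu s gs)).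
have : iid_exp (joint2 mu s gs) m
    (fun d => (~~ `[< good h >] && oracles_fail h d)%:R) <= delta'.
  case: asboolP => [_|/(oracles_succeed hb)//] /=.
  by rewrite (iid_exp_const (joint2_sum1 mu s gs)).
by rewrite -natr1 mulrDl mul1r {2}/failure_rate; lra.
Qed.

End Success.

(** * Reasoning about programs *)

Section RandTrees.
Variables (R : realType).

Fixpoint valid (X : Type) (t : rand R X) : Prop :=
  if t is Toss p t1 t0 then [/\ 0 <= p <= 1, valid t1 & valid t0] else True.

Fixpoint expect (X : Type) (t : rand R X) (F : X -> R) : R :=
  match t with
  | Ret a => F a
  | Toss p t1 t0 => p * expect t1 F + (1 - p) * expect t0 F
  end.

Lemma on_leavesP X (t : rand R X) (Q : X -> Prop) :
  on_leaves t Q <-> forall a, is_leaf t a -> Q a.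
Proof.
elim: t => [a|p t1 [IH1 IH1'] t0 [IH0 IH0']] /=; first by split => [? ? <-|]; [|apply].
split=> [[/IH1 h1 /IH0 h0] a [/h1|/h0]//|h].
by split; [apply: IH1' => a ha; apply: h; left|apply: IH0' => a ha; apply: h; right].
Qed.

Lemma is_leaf_rbind X Y (t : rand R X) (k : X -> rand R Y) b :
  is_leaf (rbind t k) b -> exists2 a, is_leaf t a & is_leaf (k a) b.
Proof.
elim: t => [a|p t1 IH1 t0 IH0] /=; first by exists a.
by case=> [/IH1|/IH0] [a ha hb]; exists a => //; [left|right].
Qed.

Lemma expect_rbind X Y (t : rand R X) (k : X -> rand R Y) F :
  expect (rbind t k) F = expect t (fun a => expect (k a) F).
Proof. by elim: t => [a|p t1 IH1 t0 IH0] //=; rewrite IH1 IH0. Qed.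

Lemma valid_rbind X Y (t : rand R X) (k : X -> rand R Y) :
  valid t -> (forall a, is_leaf t a -> valid (k a)) -> valid (rbind t k).
Proof.
elim: t => [a _ h|p t1 IH1 t0 IH0 /= [p01 v1 v0] h]; first exact: h.
split => //; [apply: IH1|apply: IH0] => // a ha; apply: h; [left|right] => //.
Qed.

Lemma le_expect X (t : rand R X) F G :
  valid t -> (forall a, is_leaf t a -> F a <= G a) -> expect t F <= expect t G.
Proof.
elim: t => [a _ h|p t1 IH1 t0 IH0 /= [/andP[p0 p1] v1 v0] h]; first exact: h.
apply: lerD; apply: ler_wpM2l; rewrite ?subr_ge0 //.
  by apply: IH1 => // a ha; apply: h; left.
by apply: IH0 => // a ha; apply: h; right.
Qed.

Lemma rprob_expect X (t : rand R X) Q :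
  rprob t Q = expect t (fun a => `[< Q a >]%:R).
Proof. by elim: t => [a|p t1 IH1 t0 IH0] //=; rewrite IH1 IH0. Qed.

End RandTrees.

Section ProgramLogic.
Variables (R : realType) (L : nat) (P : Type) (coord : P -> nat -> R).
Variable O : option (oracles R L P).
Local Notation state := (state R L P).
Local Notation exec := (exec coord O).

Definition det (c : cmd R) (s : state) (Q : state -> Prop) (w : nat) : Prop :=
  exists s', [/\ exec c s (Ret s'), Q s' & (clock s' <= clock s + w)%N].

(** Total correctness with a time budget w, and v as a lower bound on the expected payoff V in the
    style of weakest pre-expectations. A lower bound is enough, since only the success probability
    has to be tracked. *)
Definition wp (c : cmd R) (s : state) (Q : state -> Prop) (w : nat)
    (V : state -> R) (v : R) : Prop :=
  exists t, [/\ exec c s t, valid t,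
    on_leaves t (fun s' => Q s' /\ (clock s' <= clock s + w)%N) &
    v <= expect t V].

Lemma det_weaken c s (Q Q' : state -> Prop) w w' :
  det c s Q w -> (forall s', Q s' -> Q' s') -> (w <= w')%N -> det c s Q' w'.
Proof.
case=> s' [e q cw] QQ ww; exists s'; split => //; first exact: QQ.
by apply: (leq_trans cw); rewrite leq_add2l.
Qed.

Lemma det_skip s (Q : state -> Prop) : Q (tick 1 s) -> det Skip s Q 1.
Proof. by move=> q; exists (tick 1 s); split => //; exact: exec_skip. Qed.

Lemma det_setN a e s (Q : state -> Prop) w :
  Q (tick w (set_nmem (upd (nmem s) (neval s a) (neval s e)) s)) ->
  w = (nsize a + nsize e).+1 -> det (SetN a e) s Q w.
Proof. by move=> q wE; eexists; split; [exact: exec_setN| |]; rewrite -wE. Qed.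

Lemma det_setR a e s (Q : state -> Prop) w :
  Q (tick w (set_rmem (upd (rmem s) (neval s a) (reval coord s e)) s)) ->
  w = (nsize a + rsize e).+1 -> det (SetR a e) s Q w.
Proof. by move=> q wE; eexists; split; [exact: exec_setR| |]; rewrite -wE. Qed.

Lemma det_seq c1 c2 s Q1 Q2 w1 w2 :
  det c1 s Q1 w1 -> (forall s', Q1 s' -> det c2 s' Q2 w2) ->
  det (Seq c1 c2) s Q2 (w1 + w2).
Proof.
case=> s1 [e1 q1 cl1] /(_ s1 q1) [s2 [e2 q2 cl2]].
exists s2; split=> //; last by apply: (leq_trans cl2); rewrite addnA leq_add2r.
by apply: (exec_seq (k := fun=> Ret s2) e1) => s' /= <-.
Qed.

Lemma det_if b c1 c0 s Q w :
  det (if beval coord s b then c1 else c0) (tick (bsize b).+1 s) Q w ->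
  det (If b c1 c0) s Q ((bsize b).+1 + w).
Proof.
by case=> s' [e q cl]; exists s'; split => //; [exact: exec_if|rewrite addnA].
Qed.

Fixpoint repeat_cmd (k : nat) (c : nat -> cmd R) : cmd R :=
  if k is k'.+1 then Seq (repeat_cmd k' c) (c k') else Skip.

Lemma det_repeat k c s (I : nat -> state -> Prop) w :
  I 0 (tick 1 s) ->
  (forall i s', (i < k)%N -> I i s' -> det (c i) s' (I i.+1) w) ->
  det (repeat_cmd k c) s (I k) (k * w).+1.
Proof.
move=> I0 step.
have : forall i, (i <= k)%N -> det (repeat_cmd i c) s (I i) (i * w).+1.
  elim=> [_|i IH ik]; first exact: det_skip.
  rewrite mulSn addnC -addSn; apply: (det_seq (IH (ltnW ik))) => s'.
  exact: step.
exact.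
Qed.

Lemma wp_weaken c s (Q Q' : state -> Prop) w w' V v v' :
  wp c s Q w V v -> (forall s', Q s' -> Q' s') -> (w <= w')%N -> v' <= v ->
  wp c s Q' w' V v'.
Proof.
case=> t [e vt /on_leavesP l vV] QQ ww vv; exists t; split => //; last exact: le_trans vV.
apply/on_leavesP => s' /l [q cl]; split; first exact: QQ.
by apply: (leq_trans cl); rewrite leq_add2l.
Qed.

Lemma wp_det c s Q w (V : state -> R) v :
  det c s Q w -> (forall s', Q s' -> v <= V s') -> wp c s Q w V v.
Proof. by case=> s' [e q cl] h; exists (Ret s'); split => //; exact: h. Qed.

(** The payoff [V1] of the first command is the bound that the second one must guarantee from each
    intermediate state, so expectations compose along the tree. *)
Lemma wp_seq c1 c2 s Q1 Q2 w1 w2 V1 V2 v :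
  wp c1 s Q1 w1 V1 v -> (forall s', Q1 s' -> wp c2 s' Q2 w2 V2 (V1 s')) ->
  wp (Seq c1 c2) s Q2 (w1 + w2) V2 v.
Proof.
case=> t1 [e1 v1 /on_leavesP l1 vV1] h2.
have /choice [k kP] : forall s', exists t, is_leaf t1 s' ->
    [/\ exec c2 s' t, valid t,
      on_leaves t (fun s'' => Q2 s'' /\ (clock s'' <= clock s' + w2)%N) &
      V1 s' <= expect t V2].
  (* Continuations are chosen for all states at once; [Ret s'] is a default for the unreachable
     ones. *)
  move=> s'; case: (pselect (is_leaf t1 s')) => [lf|nlf]; last by exists (Ret s').
  by have [t tP] := h2 s' (l1 s' lf).1; exists t.
exists (rbind t1 k); split.
- by apply: (exec_seq e1) => s' /kP [].
- by apply: valid_rbind => // s' /kP [].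
- apply/on_leavesP => s2 lf2; have [s' lf {}lf2] := is_leaf_rbind lf2.
  have [_ _ /on_leavesP l2 _] := kP s' lf.
  have [q cl] := l2 _ lf2; split => //.
  by apply: (leq_trans cl); rewrite addnA leq_add2r; exact: (l1 _ lf).2.
- rewrite expect_rbind; apply: (le_trans vV1); apply: le_expect => // s' /kP [] //.
Qed.

Lemma wp_if b c1 c0 s Q w V v :
  wp (if beval coord s b then c1 else c0) (tick (bsize b).+1 s) Q w V v ->
  wp (If b c1 c0) s Q ((bsize b).+1 + w) V v.
Proof.
by case=> t [e vt l vV]; exists t; split => //; [exact: exec_if|rewrite addnA].
Qed.

Lemma wp_while_loop b c s Q w V v :
  beval coord s b -> wp (Seq c (While b c)) (tick (bsize b).+1 s) Q w V v ->
  wp (While b c) s Q ((bsize b).+1 + w) V v.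
Proof.
move=> sb [t [e vt l vV]]; exists t; split => //; last by rewrite addnA.
exact: exec_while_loop.
Qed.

Lemma det_while_stop b c s (Q : state -> Prop) :
  ~~ beval coord s b -> Q (tick (bsize b).+1 s) ->
  det (While b c) s Q (bsize b).+1.
Proof. by move=> sb q; eexists; split; [exact: exec_while_stop| |]. Qed.

Lemma wp_flip a e s (Q : state -> Prop) w (V : state -> R) v :
  let out (b : bool) := tick w (set_nmem (upd (nmem s) (neval s a) b) s) in
  let p := reval coord s e in
  0 <= p <= 1 -> (forall b, Q (out b)) ->
  v <= p * V (out true) + (1 - p) * V (out false) ->
  w = (nsize a + rsize e).+1 -> wp (Flip a e) s Q w V v.
Proof.
move=> out p p01 q vV wE; exists (Toss p (Ret (out true)) (Ret (out false))).
by split => //; rewrite /out wE; exact: exec_flip.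
Qed.

End ProgramLogic.

(** * The program *)

(* Number cells: 0 and 1 hold m and N, 2 the index of the current point, 3 the
   number of triples stored so far, 4, 5 and 6 the addresses of the next triple,
   label pair and simplex point, 7 and 8 the sampled label and the last coin;
   the labels of the data points k >= 7 are kept in the cells 2 + k.
   Real cells: from 0 on the value of the hypothesis, from L on the output of an
   oracle, 2 L a scratch cell, 2 L + 1 and 2 L + 2 the two test sums, from
   2 L + 3 on the K flags of the rounds (1 for an update by the distinguisher, 2
   for the calibrator, 0 for none), and after them the input of the calibrator.
   All loops but the one over m are unrolled. *)
Section Program.
Variables (R : realType) (L K M : nat) (eta thr : R).

Definition cell (k : nat) : nexp := NGet (NLit k).
Definition rcell (k : nat) : rexp R := RGet (NLit k).
Definition scratch : nat := 2 * L.
Definition sum_A : nat := (2 * L).+1.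
Definition sum_B : nat := (2 * L).+2.
Definition flag (i : nat) : nat := ((2 * L).+3 + i)%N.
Definition inputs_B : nat := flag K.

Fixpoint dot_rexp (k : nat) : rexp R :=
  if k is k'.+1 then RAdd (dot_rexp k') (RMul (rcell k') (rcell (L + k')))
  else RLit 0.

Definition mw_cmd : cmd R :=
  Seq (SetR (NLit scratch) (RSub (RLit 1) (RMul (RLit eta) (dot_rexp L))))
      (repeat_cmd L (fun l => SetR (NLit l)
         (RDiv (RMul (rcell l) (RSub (RLit 1) (RMul (RLit eta) (rcell (L + l)))))
               (rcell scratch)))).

(** The handle number is the round number for both oracles, since every round calls both. *)
Definition replay_cmd (i : nat) : cmd R :=
  If (RLt (RLit 1) (rcell (flag i)))
     (Seq (EvalB (NLit i) (NLit 0) (NLit L)) mw_cmd)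
     (If (RLt (RLit 0) (rcell (flag i)))
         (Seq (EvalA (NLit i) (cell 2) (NLit L)) mw_cmd)
         Skip).

Definition eval_cmd : cmd R :=
  Seq (repeat_cmd L (fun l => SetR (NLit l) (RLit (L%:R^-1))))
      (repeat_cmd K replay_cmd).

(* Reservoir sampling: label l replaces the current one with probability
   v l / (v 0 + ... + v l). *)
Definition label_cmd : cmd R :=
  Seq (SetR (NLit scratch) (RLit 0))
 (Seq (SetN (NLit 7) (NLit 0))
      (repeat_cmd L (fun l =>
         Seq (SetR (NLit scratch) (RAdd (rcell scratch) (rcell l)))
        (Seq (Flip (NLit 8) (RDiv (rcell l) (rcell scratch)))
             (If (NLt (NLit 0) (cell 8)) (SetN (NLit 7) (NLit l)) Skip))))).

Definition label_addr : nexp := NAdd (NLit 2) (cell 2).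

Definition store_cmd : cmd R :=
  Seq (SetN (cell 4) (cell 2))
 (Seq (SetN (NAdd (cell 4) (NLit 1)) (cell 7))
 (Seq (SetN (NAdd (cell 4) (NLit 2)) (NGet label_addr))
 (Seq (SetN (cell 5) (cell 7))
 (Seq (SetN (NAdd (cell 5) (NLit 1)) (NGet label_addr))
 (Seq (repeat_cmd L (fun l => SetR (NAdd (cell 6) (NLit l)) (rcell l)))
 (Seq (SetN (NLit 4) (NAdd (cell 4) (NLit 3)))
 (Seq (SetN (NLit 5) (NAdd (cell 5) (NLit 2)))
 (Seq (SetN (NLit 6) (NAdd (cell 6) (NLit L)))
 (Seq (SetN (NLit 3) (NAdd (cell 3) (NLit 1)))
      (SetN (NLit 2) (NAdd (cell 2) (NLit 1)))))))))))).

Definition sample_cmd : cmd R := Seq eval_cmd (Seq label_cmd store_cmd).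

(** The labels of the data end at cell N + 1. *)
Definition triples_addr : nexp := NAdd (cell 1) (NLit 2).
Definition pairs_addr : nexp :=
  NAdd triples_addr (NAdd (cell 0) (NAdd (cell 0) (cell 0))).

Definition sampling_cmd : cmd R :=
  Seq (SetN (NLit 3) (NLit 0))
 (Seq (SetN (NLit 4) triples_addr)
 (Seq (SetN (NLit 5) pairs_addr)
 (Seq (SetN (NLit 6) (NLit inputs_B))
      (While (NLt (cell 3) (cell 0)) sample_cmd)))).

Definition score_rexp : rexp R :=
  RSub (dot_rexp L) (RGet (NAdd (NLit L) (NGet label_addr))).

Definition score_cmd (t : nat) : cmd R :=
  Seq eval_cmd
 (Seq (EvalA (NLit t) (cell 2) (NLit L))
 (Seq (SetR (NLit sum_A) (RAdd (rcell sum_A) score_rexp))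
 (Seq (EvalB (NLit t) (NLit 0) (NLit L))
 (Seq (SetR (NLit sum_B) (RAdd (rcell sum_B) score_rexp))
      (SetN (NLit 2) (NAdd (cell 2) (NLit 1))))))).

Definition test_cmd (t : nat) : cmd R :=
  Seq (SetR (NLit sum_A) (RLit 0))
 (Seq (SetR (NLit sum_B) (RLit 0))
      (repeat_cmd M (fun=> score_cmd t))).

Definition call_cmd : cmd R :=
  Seq (CallA triples_addr) (CallB (NLit inputs_B) pairs_addr).

(* The rounds K - j, ..., K - 1. *)
Fixpoint rounds_cmd (j : nat) : cmd R :=
  if j is j'.+1 then
    let t := (K - j)%N in
    Seq sampling_cmd (Seq call_cmd (Seq (test_cmd t)
     (If (RLt (RLit thr) (rcell sum_A))
         (Seq (SetR (NLit (flag t)) (RLit 1)) (rounds_cmd j'))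
     (If (RLt (RLit thr) (rcell sum_B))
         (Seq (SetR (NLit (flag t)) (RLit 2)) (rounds_cmd j'))
         Skip))))
  else Skip.

(** The point index starts at 7 because the working cells 2 to 8 overwrite the labels of points 0 to
    6; these points are sacrificed. In [apply] it is set to N, the index at which the argument is
    appended. *)
Definition learner : procedure R :=
  Procedure (Seq (SetN (NLit 2) (NLit 7)) (rounds_cmd K))
            (Seq (SetN (NLit 2) (cell 1)) eval_cmd).

Lemma rsize_dot k : rsize (dot_rexp k) = (6 * k + 1)%N.
Proof. by elim: k => [|k IH] //=; rewrite IH; lia. Qed.

End Program.

Ltac address := rewrite /inputs_B /flag /sum_A /sum_B /scratch; lia.

(** * Evaluating the current hypothesis by replaying the history *)

Section EvalCorrect.
Variables (R : realType) (n L K : nat) (l0 : 'I_L) (eta : R).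
Local Notation P := (cube n).
Variables (coord : P -> nat -> R) (E : oracles R L P).
Local Notation state := (state R L P).
Local Notation det := (det coord (Some E)).
Local Notation wp := (wp coord (Some E)).
Local Notation T := (or_time E).
Local Notation hyp := (hypothesis_of l0 eta).
Implicit Types (s : state) (v : simplex R L) (q : vec R L) (h : seq (round R n L)).

Definition vec_at s (a : nat) (q : vec R L) : Prop :=
  forall l : 'I_L, rmem s (a + l)%N = q l.

Definition frame s s' : Prop :=
  [/\ nmem s' = nmem s, points s' = points s, funsA s' = funsA s,
      funsB s' = funsB s & forall a, (2 * L < a)%N -> rmem s' a = rmem s a].

Lemma frame_trans s1 s2 s3 : frame s1 s2 -> frame s2 s3 -> frame s1 s3.
Proof.
case=> n1 p1 a1 b1 r1 [n2 p2 a2 b2 r2].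
by split; rewrite ?n2 ?p2 ?a2 ?b2 // => a La; rewrite r2 // r1.
Qed.

Lemma det_evalA k j a s f x (Q : state -> Prop) w :
  onth (funsA s) (neval s k) = Some f -> onth (points s) (neval s j) = Some x ->
  Q (tick w (set_rmem (store_vec (rmem s) (neval s a) (f x)) s)) ->
  w = (nsize k + nsize j + nsize a + L + T).+1 -> det (EvalA k j a) s Q w.
Proof.
by move=> sf sx q wE; eexists; split; [exact: exec_evalA sf sx| |]; rewrite -wE.
Qed.

Lemma det_evalB k a b s r v (Q : state -> Prop) w :
  onth (funsB s) (neval s k) = Some r -> vec_at s (neval s a) (pmf v) ->
  Q (tick w (set_rmem (store_vec (rmem s) (neval s b) (r v)) s)) ->
  w = (nsize k + nsize a + nsize b + L + T).+1 -> det (EvalB k a b) s Q w.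
Proof.
by move=> sr sv q wE; eexists; split; [exact: exec_evalB sr sv| |]; rewrite -wE.
Qed.

Lemma store_vec_in (f : nat -> R) a q (l : 'I_L) :
  store_vec f a q (a + l)%N = q l.
Proof. by rewrite /store_vec leq_addr addKn insubT //= => lL; congr (q _); apply: val_inj. Qed.

Lemma store_vec_out (f : nat -> R) a q b :
  (b < a)%N || (a + L <= b)%N -> store_vec f a q b = f b.
Proof.
rewrite /store_vec; case: leqP => //= ab; rewrite ?ltnNge ?ab //= => h.
by rewrite insubF //; apply/negbTE; rewrite -leqNgt; lia.
Qed.

Lemma reval_dot s v q : vec_at s 0 (pmf v) -> vec_at s L q ->
  reval coord s (dot_rexp R L L) = dotv (pmf v) q.
Proof.
move=> sv sq.
have -> k : reval coord s (dot_rexp R L k) = \sum_(i < k) rmem s i * rmem s (L + i)%N.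
  by elim: k => [|k IH]; rewrite ?big_ord0 // big_ord_recr /= IH.
by apply: eq_bigr => l _; rewrite -sv -sq.
Qed.

Lemma upd_same (V : Type) (f : nat -> V) a x : upd f a x a = x.
Proof. by rewrite /upd eqxx. Qed.

Lemma upd_other (V : Type) (f : nat -> V) a x b : b != a -> upd f a x b = f b.
Proof. by rewrite /upd => /negbTE ->. Qed.

(** The flags beyond the history are 0, so replaying all K rounds performs exactly the updates of h.
    Handles are constrained only below [size h], as the last round may add a pair without an
    update. *)
Definition recorded h s : Prop :=
  [/\ (size h <= K)%N,
    forall i, (i < K)%N -> rmem s (flag L i) =
      if (i < size h)%N then (if use_A (nth (round0 R n L) h i) then 1 else 2) else 0,
    forall i, (i < size h)%N -> onth (funsA s) i = Some (out_A (nth (round0 R n L) h i)) &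
    forall i, (i < size h)%N -> onth (funsB s) i = Some (out_B (nth (round0 R n L) h i))].

Lemma recorded_frame h s s' : recorded h s -> frame s s' -> recorded h s'.
Proof.
case=> hK fl fA fB [_ _ eA eB er]; split => //; rewrite ?eA ?eB //.
by move=> i iK; rewrite er /flag; [exact: fl|lia].
Qed.

Hypothesis eta_itv : 0 < eta <= 1 / 2.

Lemma det_mw s v q : vec_at s 0 (pmf v) -> vec_at s L q -> bounded q ->
  det (mw_cmd L eta) s
    (fun s' => vec_at s' 0 (pmf (mw eta v q)) /\ frame s s') (20 * L + 20).
Proof.
move=> sv sq qb.
(* The update can be done in place: the normaliser is already in the scratch cell, and each
   coordinate reads only its own old value. *)
pose I i s' := [/\ forall l : 'I_L, rmem s' l = if (l < i)%N then mw eta v q l else v l,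
   vec_at s' L q, rmem s' (2 * L)%N = 1 - eta * dotv v q & frame s s'].
apply: (@det_weaken _ _ _ _ _ _ _ (I L) _ ((6 * L + 7) + (L * 14).+1)); last by lia.
  apply: (det_seq (Q1 := I 0%N)).
    apply: det_setR; last by rewrite /= rsize_dot; lia.
    have s0 l : (l < 2 * L)%N -> upd (rmem s) (2 * L)%N (1 - eta * dotv v q) l = rmem s l.
      by move=> ?; apply: upd_other; address.
    rewrite /= (reval_dot sv sq); split => /=.
    - by move=> l; rewrite s0 //; [exact: sv|have := ltn_ord l; lia].
    - by move=> l /=; rewrite s0 //; have := ltn_ord l; lia.
    - exact: upd_same.
    - by split => //= a La; apply: upd_other; address.
  move=> s1 I0; apply: det_repeat => // i s' iL [h1 h2 h3 h4].
  apply: det_setR => //=; set x := (_ / _).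
  have xE : x = mw eta v q (Ordinal iL).
    rewrite /x h3 (h1 (Ordinal iL)) (h2 (Ordinal iL)) /= ltnn mwE //.
  split => /=.
  - move=> l; rewrite /upd; case: eqP => [li|/eqP li].
      by rewrite xE ltnS (_ : Ordinal iL = l) ?li ?leqnn //; exact: val_inj.
    by rewrite h1 ltnS ltn_neqAle li.
  - by move=> l /=; rewrite upd_other //; address.
  - by rewrite upd_other //; address.
  - by apply: (frame_trans h4); split => //= a La; apply: upd_other; address.
move=> s' [h1 _ _ h4]; split => // l.
by rewrite h1 ltn_ord.
Qed.

Definition eval_time : nat := K * (21 * L + 40 + T) + 4 * L + 10.

Lemma det_eval h s x : bounded_rounds h -> recorded h s ->
  onth (points s) (nmem s 2) = Some x ->
  det (eval_cmd L K eta) s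
    (fun s' => vec_at s' 0 (pmf (hyp h x)) /\ frame s s') eval_time.
Proof.
move=> hb hs sx.
(* After i flags the cells hold the hypothesis of the first i rounds; past the end of h, [take] no
   longer changes and neither do the cells. *)
pose I i s' := vec_at s' 0 (pmf (hyp (take i h) x)) /\ frame s s'.
apply: (@det_weaken _ _ _ _ _ _ _ (I K) _ ((L * 3).+1 + (K * (21 * L + 40 + T)).+1)); last by rewrite /eval_time; lia.
  apply: (det_seq (Q1 := I 0%N)).
    pose J i s' := (forall l : 'I_L, (l < i)%N -> rmem s' l = uniform R l0 l) /\ frame s s'.
    apply: (@det_weaken _ _ _ _ _ _ _ (J L) _ (L * 3).+1) => //; last first.
      by move=> s' [h1 h2]; split=> // l; rewrite take0 /= add0n h1.
    apply: det_repeat => // i s' iL [h1 h2]; apply: det_setR => //; split => /=.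
      move=> l; rewrite ltnS leq_eqVlt /upd; case: eqP => [_ _|_ /h1 //].
      by rewrite ffunE.
    by apply: (frame_trans h2); split => //= a La; apply: upd_other; address.
  move=> s1 I0; apply: det_repeat => // i s' iK [h1 h2].
  have [hK fl fA fB] := recorded_frame hs h2.
  have [ni pi _ _ _] := h2.
  case: (ltnP i (size h)) (fl i iK) => [ih|hi] fli; last first.
    rewrite /replay_cmd; apply: (@det_weaken _ _ _ _ _ _ _ (I i.+1) _ (5 + (5 + 1))) => //; last by lia.
    apply: det_if; rewrite /= fli ltNge ler01 /=; apply: det_if; rewrite /= fli ltxx.
    apply: det_skip; split => //=.
    by move=> l; rewrite take_oversize ?(leq_trans hi) //; have := h1 l; rewrite take_oversize.
  have hT : hyp (take i.+1 h) x = mw eta (hyp (take i h) x)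
      (update_fun (nth (round0 R n L) h i) x (hyp (take i h) x)).
    by rewrite (take_nth (round0 R n L) ih) hypothesis_of_rcons.
  have ub := bounded_update x (hyp (take i h) x) (hb i ih).
  move: ub fli hT; rewrite /update_fun.
  have frameL q w : frame s' (tick w (set_rmem (store_vec (rmem s') L q) s')).
    by split => //= a La; apply: store_vec_out; lia.
  have vL q w : vec_at (tick w (set_rmem (store_vec (rmem s') L q) s')) 0 (pmf (hyp (take i h) x)).
    by move=> l /=; rewrite store_vec_out ?h1 // add0n ltn_ord.
  have qL q w : vec_at (tick w (set_rmem (store_vec (rmem s') L q) s')) L q.
    by move=> l; exact: store_vec_in.
  pose mid q s2 := [/\ vec_at s2 0 (pmf (hyp (take i h) x)), vec_at s2 L q & frame s' s2].
  have finish q s2 : bounded q -> hyp (take i.+1 h) x = mw eta (hyp (take i h) x) q ->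
      mid q s2 -> det (mw_cmd L eta) s2 (I i.+1) (20 * L + 20).
    move=> qb hT [v2 q2 fr2]; apply: det_weaken (det_mw v2 q2 qb) _ _ => // s3 [v3 fr3].
    by split; [rewrite hT|apply: (frame_trans h2); exact: (frame_trans fr2)].
  case: (use_A _) => ub fli hT.
    apply: (@det_weaken _ _ _ _ _ _ _ (I i.+1) _ (5 + (5 + ((1 + 2 + 1 + L + T).+1 + (20 * L + 20))))) => //; last by lia.
    apply: det_if; rewrite /= fli ltxx; apply: det_if; rewrite /= fli ltr01.
    apply: det_seq; last by move=> s2; exact: finish.
    apply: det_evalA => //=; [exact: fA|rewrite ni pi; exact: sx|].
    by split; [exact: (vL _ 0)|exact: (qL _ 0)|exact: (frameL _ 0)].
  apply: (@det_weaken _ _ _ _ _ _ _ (I i.+1) _ (5 + ((1 + 1 + 1 + L + T).+1 + (20 * L + 20)))) => //; last by lia.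
  apply: det_if; rewrite /= fli ltr1n.
  apply: det_seq; last by move=> s2; exact: finish.
  apply: det_evalB => //=; [exact: fB|exact: h1|].
  by split; [exact: (vL _ 0)|exact: (qL _ 0)|exact: (frameL _ 0)].
move=> s' [h1 h2]; split => //; rewrite -(take_oversize (n := K) (s := h)) //.
by case: hs.
Qed.

End EvalCorrect.

Lemma wp_seq_det (R : realType) (L : nat) (P : Type) (coord : P -> nat -> R)
    (O : option (oracles R L P)) c1 c2 s Q1 Q2 w1 w2 V v :
  det coord O c1 s Q1 w1 -> (forall s', Q1 s' -> wp coord O c2 s' Q2 w2 V v) ->
  wp coord O (Seq c1 c2) s Q2 (w1 + w2) V v.
Proof.
by move=> h1 h2; apply: (wp_seq (V1 := fun=> v)) h2; exact: (wp_det h1).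
Qed.

(** * Reservoir sampling of a label *)

Section Reservoir.
Variables (R : realType) (L : nat) (l0 : 'I_L) (v : simplex R L).
Hypothesis v_pos : positive v.

Local Notation prefix k := (\sum_(i < k) simplex_coord v i).

Lemma simplex_coord_pos k : (k < L)%N -> 0 < simplex_coord v k.
Proof. by move=> kL; rewrite /simplex_coord insubT. Qed.

Lemma prefix_pos k : (0 < k <= L)%N -> 0 < prefix k.
Proof.
case: k => // k /andP[_ kL]; rewrite big_ord_recr /= ltr_wpDl ?simplex_coord_pos //.
apply: sumr_ge0 => i _; apply/ltW/simplex_coord_pos.
by apply: leq_trans kL; apply: (leq_trans (ltn_ord i)).
Qed.

(* The average of F over the label held by the reservoir after k labels. *)
Fixpoint reservoir (F : nat -> R) (k : nat) : R :=
  if k is k'.+1 then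
    let p := simplex_coord v k' / prefix k in
    p * F k' + (1 - p) * reservoir F k'
  else F 0%N.

(** Lets the mixture created by the last coin be absorbed into the payoff of the earlier
    iterations. *)
Lemma reservoir_affine F a b k :
  reservoir (fun y => a + b * F y) k = a + b * reservoir F k.
Proof. by elim: k => [|k IH] //=; rewrite IH; ring. Qed.

(** Multiplying by the new prefix sum turns p into the weight of the new label and 1 - p into the
    old prefix sum. *)
Lemma reservoir_prefix F k : (k <= L)%N ->
  prefix k * reservoir F k = \sum_(i < k) simplex_coord v i * F i.
Proof.
elim: k => [_|k IH kL]; first by rewrite !big_ord0 mul0r.
rewrite [RHS]big_ord_recr /= -IH ?(ltnW kL) //.
have := prefix_pos (k := k.+1) kL; rewrite big_ord_recr /= => /lt0r_neq0 nz.
by field.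
Qed.

Lemma reservoirE F : reservoir F L = \sum_(l < L) v l * F l.
Proof.
have := reservoir_prefix F (leqnn L).
have -> : prefix L = 1.
  rewrite -[RHS](pmf_sum1 v); apply: eq_bigr => l _.
  by rewrite /simplex_coord valK.
by rewrite mul1r => ->; apply: eq_bigr => l _; rewrite /simplex_coord valK.
Qed.

Variables (P : Type) (coord : P -> nat -> R) (O : option (oracles R L P)).
Local Notation state := (state R L P).

Definition label_frame (s s' : state) : Prop :=
  [/\ forall a, a \notin [:: 7; 8]%N -> nmem s' a = nmem s a,
      points s' = points s, funsA s' = funsA s, funsB s' = funsB s &
      forall a, a != (2 * L)%N -> rmem s' a = rmem s a].

Lemma label_frame_trans s1 s2 s3 :
  label_frame s1 s2 -> label_frame s2 s3 -> label_frame s1 s3.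
Proof.
case=> n1 p1 a1 b1 r1 [n2 p2 a2 b2 r2].
split; rewrite ?p2 ?a2 ?b2 // => a ha; first by rewrite n2 // n1.
by rewrite r2 // r1.
Qed.

Lemma wp_label (s : state) (V : state -> R) (F : 'I_L -> R) :
  (forall l : 'I_L, rmem s l = v l) ->
  (forall s' y, label_frame s s' -> nmem s' 7 = val y -> F y <= V s') ->
  wp coord O (label_cmd R L) s
    (fun s' => label_frame s s' /\ exists y : 'I_L, nmem s' 7 = val y)
    (30 * L + 10) V (\sum_l v l * F l).
Proof.
move=> sv FV; have L0 : (0 < L)%N by case: L l0 => // -[].
(* The bound [k.-1] covers k = 0, where the cell already holds the initial label 0. *)
pose J k s' := [/\ rmem s' (2 * L)%N = prefix k, (nmem s' 7 <= k.-1)%N & label_frame s s'].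
have main k s1 V1 F1 : (k <= L)%N -> J 0%N s1 ->
  (forall s', J k s' -> F1 (nmem s' 7) <= V1 s') ->
  wp coord O (repeat_cmd k (fun l =>
         Seq (SetR (NLit (scratch L)) (RAdd (rcell R (scratch L)) (rcell R l)))
        (Seq (Flip (NLit 8) (RDiv (rcell R l) (rcell R (scratch L))))
             (If (NLt (NLit 0) (cell 8)) (SetN (NLit 7) (NLit l)) Skip)))) s1
     (J k) (k * 30).+1 V1 (reservoir F1 k).
  elim: k V1 F1 => [|k IH] V1 F1 kL J0 FV1.
    apply: (@wp_det _ _ _ _ _ _ _ (J 0%N)); first exact: det_skip.
    move=> s' J1; apply: le_trans (FV1 _ J1).
    by case: J1 => _; rewrite leqn0 => /eqP ->.
  have -> : ((k.+1 * 30).+1 = (k * 30).+1 + 30)%N by lia.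
  set p := simplex_coord v k / prefix k.+1.
  (* The payoff before the last iteration is the expectation over its coin; it is affine in [F1] of
     the label held so far. *)
  pose V2 (s' : state) := p * F1 k + (1 - p) * F1 (nmem s' 7).
  have /= := IH V2 (fun y => p * F1 k + (1 - p) * F1 y) (ltnW kL) J0 (fun _ _ => lexx _).
  rewrite reservoir_affine => h1.
  apply: (wp_seq h1) => s2 [z2 y2 fr2].
  have pos := prefix_pos (k := k.+1) kL.
  have p01 : 0 <= p <= 1.
    apply/andP; split; first by apply: divr_ge0; [apply/ltW/simplex_coord_pos|exact: ltW].
    rewrite ler_pdivrMr // mul1r big_ord_recr /= lerDr.
    by apply: sumr_ge0 => i _; apply/ltW/simplex_coord_pos; apply: ltn_trans kL; exact: ltn_ord.
  have vk : rmem s2 k = simplex_coord v k.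
    case: fr2 => _ _ _ _ ->; last by lia.
    by rewrite (sv (Ordinal kL)) /simplex_coord insubT.
  apply: (@wp_weaken _ _ _ _ _ _ _ (J k.+1) _ (7 + (7 + (5 + 3)))) (lexx _) => //.
  - apply: (wp_seq_det (Q1 := fun s3 => [/\ rmem s3 (2 * L)%N = prefix k.+1,
        rmem s3 k = simplex_coord v k, (nmem s3 7 <= k.-1)%N, nmem s3 7 = nmem s2 7 & label_frame s s3])).
      apply: det_setR => //=; split => /=.
      + by rewrite upd_same z2 vk big_ord_recr.
      + by rewrite upd_other ?vk //; address.
      + by [].
      + by [].
      + apply: (label_frame_trans fr2); split => //= a La.
        by rewrite upd_other.
    move=> s3 [z3 v3 y3 y23 fr3].
    apply: (wp_seq (Q1 := fun s4 => [/\ rmem s4 (2 * L)%N = prefix k.+1, (nmem s4 7 <= k.-1)%N,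
        nmem s4 7 = nmem s2 7 & label_frame s s4])
        (V1 := fun s4 => if (0 < nmem s4 8)%N then F1 k else F1 (nmem s4 7))).
      have pE : reval coord s3 (RDiv (rcell R k) (rcell R (scratch L))) = p by rewrite /= v3 z3.
      apply: wp_flip; rewrite ?pE //=.
      + move=> b; split => //=.
        apply: (label_frame_trans fr3); split => //= a.
        by rewrite !inE negb_or => /andP[_ a8]; rewrite upd_other.
      + by rewrite /V2 /upd /= -y23 lexx.
    move=> s4 [z4 y4 y24 fr4].
    have stop s5 : nmem s5 7 = nmem s4 7 \/ nmem s5 7 = k -> rmem s5 (2 * L)%N = prefix k.+1 -> label_frame s4 s5 -> J k.+1 s5.
      by move=> h z5 fr5; split => //; [lia|exact: label_frame_trans fr5].
    apply: wp_if; rewrite /=; case: (ltnP 0 (nmem s4 8)) => h8.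
      apply: (@wp_weaken _ _ _ _ _ _ _ (fun s5 => J k.+1 s5 /\ nmem s5 7 = k) _ 3) (lexx _) => //; last by move=> s5 [].
      apply: wp_det.
        apply: det_setN => //; split => /=; last exact: upd_same.
        apply: stop => //=; first by right; exact: upd_same.
        split => //= a; rewrite !inE negb_or => /andP[a7 _]; by rewrite upd_other.
      by move=> s5 [J5 <-]; exact: FV1.
    apply: (@wp_weaken _ _ _ _ _ _ _ (fun s5 => J k.+1 s5 /\ nmem s5 7 = nmem s4 7) _ 1) (lexx _) => //; last by move=> s5 [].
    apply: wp_det.
      by apply: det_skip; split => //; apply: stop => //; left.
    move=> s5 [J5 <-]; exact: FV1.
have -> : \sum_l v l * F l = reservoir (fun k => F (insubd l0 k)) L.
  by rewrite reservoirE; apply: eq_bigr => l _; rewrite valKd.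
apply: (@wp_weaken _ _ _ _ _ _ _ (J L) _ (3 + (3 + (L * 30).+1))) => //.
- apply: (wp_seq_det (Q1 := fun s1 => rmem s1 (2 * L)%N = 0 /\ label_frame s s1)).
    apply: det_setR => //=; split; first exact: upd_same.
    by split => //= a La; rewrite upd_other.
  move=> s1 [z1 fr1].
  apply: (wp_seq_det (Q1 := J 0%N)).
    apply: det_setN => //; split => //=; first by rewrite big_ord0.
    apply: (label_frame_trans fr1); split => //= a.
    by rewrite !inE negb_or => /andP[a7 _]; rewrite upd_other.
  move=> s2 J2; apply: main => // s3 [_ y3 fr3]; apply: FV => //.
  by rewrite val_insubd; case: ifP => // /negbT; lia.
- move=> s' [_ y' fr']; split => //.
  have yL : (nmem s' 7 < L)%N by lia.
  by exists (Ordinal yL).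
- by lia.
Qed.

End Reservoir.

Lemma onth_rcons (T : Type) (s : seq T) x k :
  onth (rcons s x) k =
  if (k < size s)%N then onth s k else if k == size s then Some x else None.
Proof.
rewrite -cats1 onth_cat; case: ltnP => // sk.
by rewrite eqn_leq sk andbT -subn_eq0; case: (k - size s)%N => [|[]].
Qed.

Lemma onth_size (T : Type) (s : seq T) k x : onth s k = Some x -> (k < size s)%N.
Proof. by move=> sk; rewrite -onthTE sk. Qed.

Ltac lookup := repeat (first [rewrite upd_same | rewrite upd_other; [|address]]).

(** * Storing samples in the layouts that the two oracles read *)

Section Storing.
Variables (R : realType) (n L K : nat) (l0 : 'I_L) (eta : R).
Local Notation P := (cube n).
Local Notation triple := (P * 'I_L * 'I_L)%type.
Variables (coord : P -> nat -> R) (E : oracles R L P).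
Local Notation state := (state R L P).
Local Notation det := (det coord (Some E)).
Local Notation wp := (wp coord (Some E)).
Local Notation m := (or_m E).
Local Notation hyp := (hypothesis_of l0 eta).
Implicit Types (s : state) (v : simplex R L) (q : vec R L) (h : seq (round R n L)).
Variable D : seq (P * 'I_L).
Local Notation N := (size D).

Definition data_inv h s : Prop :=
  [/\ nmem s 0 = m, nmem s 1 = N, points s = [seq z.1 | z <- D],
    forall k z, (7 <= k)%N -> onth D k = Some z -> nmem s (2 + k)%N = z.2 &
    recorded K h s].

Definition triple_addr k : nat := (N + 2 + 3 * k)%N.
Definition pair_addr k : nat := (N + 2 + 3 * m + 2 * k)%N.
Definition input_addr k : nat := (inputs_B L K + L * k)%N.

Definition stored h o (d : seq triple) s : Prop :=
  forall k z, onth d k = Some z ->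
  [/\ onth D (o + k) = Some (z.1.1, z.2),
    [/\ nmem s (triple_addr k) = (o + k)%N, nmem s (triple_addr k).+1 = z.1.2 &
        nmem s (triple_addr k).+2 = z.2],
    nmem s (pair_addr k) = z.1.2 /\ nmem s (pair_addr k).+1 = z.2 &
    vec_at s (input_addr k) (pmf (hyp h z.1.1))].

Definition sampling_inv h o d s : Prop :=
  [/\ data_inv h s, stored h o d s, size (funsA s) = size h /\ size (funsB s) = size h &
  [/\ nmem s 2 = (o + size d)%N, nmem s 3 = size d,
    nmem s 4 = triple_addr (size d), nmem s 5 = pair_addr (size d) &
    nmem s 6 = input_addr (size d)]].

Ltac address ::= rewrite ?/triple_addr ?/pair_addr ?/input_addr /inputs_B /flag /sum_A /sum_B /scratch; lia.

(** A common frame for evaluating the hypothesis and for drawing a label. *)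
Definition almost_same s s' : Prop :=
  [/\ forall a, a \notin [:: 7; 8]%N -> nmem s' a = nmem s a,
      points s' = points s, funsA s' = funsA s, funsB s' = funsB s &
      forall a, (2 * L < a)%N -> rmem s' a = rmem s a].

Lemma label_almost_same s s' : label_frame s s' -> almost_same s s'.
Proof. by case=> n1 p1 a1 b1 r1; split => // a La; apply: r1; lia. Qed.

Lemma frame_almost_same s s' : frame s s' -> almost_same s s'.
Proof. by case=> n1 p1 a1 b1 r1; split => // a _; rewrite n1. Qed.

(** Keeps the triples, stored from cell N + 2 on, clear of the working cells, which end at 8. *)
Hypothesis N7 : (7 <= N)%N.

Lemma data_inv_almost_same h s s' : data_inv h s -> almost_same s s' -> data_inv h s'.
Proof.
case=> i0 i1 ip il [hK fl fA fB] [n1 p1 a1 b1 r1]; split => //.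
- by rewrite n1.
- by rewrite n1.
- by rewrite p1.
- by move=> k z k7 Dk; rewrite n1 ?(il _ z) // !inE; lia.
- split => //; rewrite ?a1 ?b1 //.
  by move=> i iK; rewrite r1; [exact: fl|address].
Qed.

Lemma sampling_inv_almost_same h o d s s' :
  sampling_inv h o d s -> almost_same s s' -> sampling_inv h o d s'.
Proof.
move=> [hD hs [hA hB] [c2 c3 c4 c5 c6]] ss; have := ss; case=> n1 p1 a1 b1 r1.
split; rewrite ?a1 ?b1 ?n1 //; first exact: data_inv_almost_same ss.
move=> k z dk; have [Dk [t1 t2 t3] [q1 q2] vk] := hs k z dk.
split => //; rewrite ?n1 ?inE //; try by address.
by move=> l; rewrite r1 ?vk //; address.
Qed.

Lemma det_store h o d s z (y : 'I_L) :
  sampling_inv h o d s -> (7 <= o)%N -> (size d < m)%N ->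
  onth D (o + size d) = Some z -> nmem s 7 = y ->
  vec_at s 0 (pmf (hyp h z.1)) ->
  det (store_cmd R L) s
    (fun s' => sampling_inv h o (rcons d (z.1, y, z.2)) s' /\ nmem s' 7 = y)
    (8 * L + 120).
Proof.
move=> [[i0 i1 ip il hr] hs [hA hB] [c2 c3 c4 c5 c6]] o7 dm Dz sy sv.
set i := size d in c2 c3 c4 c5 c6 dm Dz *.
have iN := onth_size Dz.
pose st f r s' := [/\ nmem s' = f, rmem s' = r, points s' = points s, funsA s' = funsA s & funsB s' = funsB s].
have setN a e f r s' ka kv w : st f r s' -> neval s' a = ka -> neval s' e = kv ->
    w = (nsize a + nsize e).+1 -> det (SetN a e) s' (st (upd f ka kv) r) w.
  by move=> [ef er ep ea eb] ha he hw; apply: det_setN => //; split => //=; rewrite ha he ef.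
have lab : nmem s (2 + (o + i))%N = z.2 by apply: il => //; lia.
(* The number memory is written out as iterated updates, after the stores ([f5]) and after advancing
   the counters ([f11]), so every later read reduces to comparing addresses. *)
pose f5 := upd (upd (upd (upd (upd (nmem s) (triple_addr i) (o + i)%N) (triple_addr i).+1 y)
   (triple_addr i).+2 z.2) (pair_addr i) y) (pair_addr i).+1 z.2.
pose r6 := store_vec (rmem s) (input_addr i) (pmf (hyp h z.1)).
pose f11 := upd (upd (upd (upd (upd f5 4 (triple_addr i.+1)) 5 (pair_addr i.+1))
   6 (input_addr i.+1)) 3 i.+1) 2 (o + i.+1)%N.
apply: (@det_weaken _ _ _ _ _ _ _ (st f11 r6) _
  (5 + (7 + (10 + (5 + (10 + ((L * 7).+1 + (6 + (6 + (6 + (6 + 6))))))))))); last by lia.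
  apply: det_seq.
    by apply: (setN _ _ (nmem s) (rmem s) s (triple_addr i) (o + i)%N) => //=; rewrite ?c4 ?c2.
  move=> s1 h1; have [e1 _ _ _ _] := h1; apply: det_seq.
    by apply: (setN _ _ _ _ _ (triple_addr i).+1 y _ h1) => //=; rewrite e1; lookup; rewrite ?c4 ?addn1.
  move=> s2 h2; have [e2 _ _ _ _] := h2; apply: det_seq.
    have q2 : nmem s2 2 = (o + i)%N by rewrite e2; lookup.
    by apply: (setN _ _ _ _ _ (triple_addr i).+2 z.2 _ h2) => //=; rewrite ?q2 e2; lookup; rewrite ?c4 ?addn2 ?lab.
  move=> s3 h3; have [e3 _ _ _ _] := h3; apply: det_seq.
    by apply: (setN _ _ _ _ _ (pair_addr i) y _ h3) => //=; rewrite e3; lookup; rewrite ?c5.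
  move=> s4 h4; have [e4 _ _ _ _] := h4; apply: det_seq.
    have q4 : nmem s4 2 = (o + i)%N by rewrite e4; lookup.
    by apply: (setN _ _ _ _ _ (pair_addr i).+1 z.2 _ h4) => //=; rewrite ?q4 e4; lookup; rewrite ?c5 ?addn1 ?lab.
  move=> s5 h5; have [e5 r5 _ _ _] := h5; apply: (det_seq (Q1 := st f5 r6)).
    (* A partially copied vector is not a [store_vec], so the real cells are described pointwise
       until the copy is complete. *)
    pose I k s' := (exists2 r, st f5 r s' & forall a, r a = if (input_addr i <= a < input_addr i + k)%N then r6 a else rmem s a).
    apply: (@det_weaken _ _ _ _ _ _ _ (I L) _ (L * 7).+1) => //; last first.
      move=> s' [r h5' rE]; suff <- : r = r6 by [].
      apply: funext => a; rewrite rE /r6; case: ifP => // /negbT; rewrite negb_and -ltnNge -leqNgt => ha.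
      by rewrite store_vec_out.
    apply: det_repeat.
      exists (rmem s) => // a; case: ifP => //; lia.
    move=> k s' kL [r [e' er p' a' b'] rE].
    apply: det_setR => //; exists (upd r (input_addr i + k)%N (hyp h z.1 (Ordinal kL))).
      split => //=; rewrite er e' /f5 /=; lookup; rewrite c6; congr upd.
      by rewrite rE ifF ?(sv (Ordinal kL)) //; address.
    move=> a; rewrite /upd; case: eqP => [->|ak].
      by rewrite leq_addr addnS ltnSn /= /r6 (store_vec_in _ _ _ (Ordinal kL)).
    by rewrite rE; congr (if _ then _ else _); lia.
  move=> s6 h6; have [e6 _ _ _ _] := h6; apply: det_seq.
    apply: (setN _ _ _ _ _ 4 (triple_addr i.+1) _ h6) => //=; rewrite e6 /f5; lookup; rewrite c4; address.
  move=> s7 h7; have [e7 _ _ _ _] := h7; apply: det_seq.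
    apply: (setN _ _ _ _ _ 5 (pair_addr i.+1) _ h7) => //=; rewrite e7 /f5; lookup; rewrite c5; address.
  move=> s8 h8; have [e8 _ _ _ _] := h8; apply: det_seq.
    apply: (setN _ _ _ _ _ 6 (input_addr i.+1) _ h8) => //=; rewrite e8 /f5; lookup; rewrite c6; address.
  move=> s9 h9; have [e9 _ _ _ _] := h9; apply: det_seq.
    apply: (setN _ _ _ _ _ 3 i.+1 _ h9) => //=; rewrite e9 /f5; lookup; rewrite c3; address.
  move=> s10 h10; have [e10 _ _ _ _] := h10.
  apply: (setN _ _ _ _ _ 2 (o + i.+1)%N _ h10) => //=; rewrite e10 /f5; lookup; rewrite c2; address.
move=> s' [ef er ep ea eb]; split; last by rewrite ef /f11 /f5; lookup.
have r6E a : (a < input_addr i)%N || (input_addr i + L <= a)%N -> r6 a = rmem s a.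
  exact: store_vec_out.
split; rewrite ?ea ?eb ?size_rcons ?ef //.
- split; rewrite ?ef ?ep //; try by rewrite /f11 /f5; lookup.
    move=> k u k7 Dk; have kN := onth_size Dk.
    by rewrite /f11 /f5; lookup; exact: il.
  case: hr => hK fl fA fB; split; rewrite ?ea ?eb // => j jK.
  by rewrite er r6E ?fl //; address.
- move=> k u; rewrite onth_rcons; case: ltnP => [ki dk|_].
    have {}ki : (k < i)%N by [].
    have [Dk [t1 t2 t3] [q1 q2] vk] := hs k u dk.
    split => //; rewrite ?ef.
    + by rewrite /f11 /f5; split; lookup.
    + by rewrite /f11 /f5; split; lookup.
    + move=> l; rewrite er r6E ?vk //; have := ltn_ord l; have : (L * k + L <= L * i)%N by rewrite -mulnSr leq_mul2l ki orbT.
      address.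
  case: eqP => // -> [<-] /=; rewrite -/i; split; rewrite ?ef.
  + by rewrite Dz; case: (z).
  + by rewrite /f11 /f5; split; lookup.
  + by rewrite /f11 /f5; split; lookup.
  + by move=> l; rewrite er /r6 store_vec_in.
Qed.

End Storing.

(** * The sampling loop, the oracle calls and the tests *)

Section SamplingAndTests.
Variables (R : realType) (n L K M : nat) (l0 : 'I_L) (eta : R).
Local Notation P := (cube n).
Local Notation triple := (P * 'I_L * 'I_L)%type.
Variables (coord : P -> nat -> R) (E : oracles R L P).
Local Notation state := (state R L P).
Local Notation det := (det coord (Some E)).
Local Notation wp := (wp coord (Some E)).
Local Notation m := (or_m E).
Local Notation hyp := (hypothesis_of l0 eta).
Implicit Types (s : state) (v : simplex R L) (q : vec R L) (h : seq (round R n L)).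
Hypothesis eta_itv : 0 < eta <= 1 / 2.
Variable D : seq (P * 'I_L).
Local Notation N := (size D).
Hypothesis N7 : (7 <= N)%N.
Local Notation sampling_inv := (sampling_inv K l0 eta E D).
Local Notation data_inv := (data_inv K E D).
Local Notation eval_time := (eval_time K E).

Definition sample_time : nat := eval_time + (30 * L + 10) + (8 * L + 120).

Lemma points_at h s k z : data_inv h s -> onth D k = Some z ->
  onth (points s) k = Some z.1.
Proof. by case=> _ _ -> _ _; rewrite onth_map => ->. Qed.

Lemma wp_sample h o d s z (V : state -> R) (F : 'I_L -> R) :
  bounded_rounds h -> sampling_inv h o d s -> (7 <= o)%N -> (size d < m)%N ->
  onth D (o + size d) = Some z ->
  (forall s' y, sampling_inv h o (rcons d (z.1, y, z.2)) s' -> nmem s' 7 = val y ->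
     F y <= V s') ->
  wp (sample_cmd L K eta) s
    (fun s' => exists y : 'I_L, sampling_inv h o (rcons d (z.1, y, z.2)) s' /\ nmem s' 7 = val y)
    sample_time V (\sum_y hyp h z.1 y * F y).
Proof.
move=> hb hs o7 dm Dz FV.
have [hD _ _ [c2 _ _ _ _]] := hs.
have [_ _ _ _ hr] := hD.
rewrite /sample_time -addnA /sample_cmd.
apply: (wp_seq_det (det_eval l0 coord E eta_itv hb hr (x := z.1) _)).
  by rewrite c2; exact: (points_at hD Dz).
move=> s1 [v1 fr1].
have vp := hypothesis_positive l0 eta_itv z.1 hb.
have [] := @wp_label R L l0 (hyp h z.1) vp P coord (Some E) s1
  (fun s' => F (insubd l0 (nmem s' 7))) F.
- by move=> l; rewrite -(v1 l) add0n.
- by move=> s' y _ ->; rewrite valKd.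
move=> t tP.
(* The intermediate payoff must be a function of the state, so the label is read back from cell 7,
   with [l0] as default. *)
apply: (@wp_seq _ _ _ _ _ _ _ _ (fun s' => label_frame s1 s' /\ exists y : 'I_L, nmem s' 7 = val y)
   _ _ _ (fun s' => F (insubd l0 (nmem s' 7)))); first by exists t.
move=> s2 [fr2 [y sy]].
have hs2 : sampling_inv h o d s2.
  apply: (sampling_inv_almost_same N7 _ (label_almost_same fr2)).
  exact: (sampling_inv_almost_same N7 hs (frame_almost_same fr1)).
have v2 : vec_at s2 0 (pmf (hyp h z.1)).
  move=> l; rewrite -v1; case: fr2 => _ _ _ _ -> //.
  by have := ltn_ord l; lia.
apply: (@wp_weaken _ _ _ _ _ _ _ (fun s' => sampling_inv h o (rcons d (z.1, y, z.2)) s' /\ nmem s' 7 = val y) _ (8 * L + 120)) (lexx _) => //.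
  apply: (wp_det (det_store coord N7 hs2 o7 dm Dz sy v2)) => s3 [h3 sy3].
  by rewrite sy valKd; exact: FV.
by move=> s3 h3; exists y.
Qed.

Definition loop_time (k : nat) : nat := k * (6 + sample_time) + 6.

(** Generalised over the triples d already stored, so that induction on the remaining data follows
    the recursion of [label_exp]. *)
Lemma wp_loop h o rest tl d s (V : state -> R) (G : seq triple -> R) :
  bounded_rounds h -> (7 <= o)%N -> sampling_inv h o d s ->
  (size d + size rest)%N = m -> drop (o + size d) D = rest ++ tl ->
  (forall s' d', sampling_inv h o d' s' -> size d' = m -> G d' <= V s') ->
  wp (While (NLt (cell 3) (cell 0)) (sample_cmd L K eta)) s
    (fun s' => exists2 d', sampling_inv h o d' s' & size d' = m)
    (loop_time (size rest)) V (label_exp (hyp h) rest (fun d' => G (d ++ d'))).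
Proof.
move=> hb o7; elim: rest d s G => [|z rest IH] d s G hs szd dropD GV /=.
  have [[i0 _ _ _ _] _ _ [_ c3 _ _ _]] := hs.
  apply: (@wp_weaken _ _ _ _ _ _ _ (sampling_inv h o d) _ 6) (lexx _) => //.
    apply: wp_det.
      by apply: det_while_stop => //=; rewrite c3 i0 -szd addn0 ltnn.
    by move=> s' hs'; rewrite cats0; apply: GV => //; rewrite -szd addn0.
  by move=> s' hs'; exists d => //; rewrite -szd addn0.
have [[i0 _ _ _ _] _ _ [_ c3 _ _ _]] := hs.
have dm : (size d < m)%N by rewrite -szd /= addnS ltnS leq_addr.
have Dz : onth D (o + size d) = Some z.
  have od : (o + size d <= N)%N.
    rewrite leqNgt; apply/negP => lt; move: dropD.
    by rewrite drop_oversize // ltnW.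
  by rewrite -(cat_take_drop (o + size d) D) onth_cat size_takel // ltnn subnn dropD.
have -> : loop_time (size rest).+1 = (6 + (sample_time + loop_time (size rest)))%N.
  by rewrite /loop_time; lia.
apply: wp_while_loop; first by rewrite /= c3 i0.
pose F y := label_exp (hyp h) rest (fun d' => G (d ++ (z.1, y, z.2) :: d')).
apply: (wp_seq (V1 := fun s' => F (insubd l0 (nmem s' 7)))).
  apply: (wp_sample (d := d) (o := o) (z := z) (F := F) hb) => //.
  by move=> s' y _ ->; rewrite valKd.
move=> s1 [y [hs1 y1]]; rewrite y1 valKd.
have := IH (rcons d (z.1, y, z.2)) s1 G hs1; rewrite size_rcons.
have -> : label_exp (hyp h) rest (fun d' => G (rcons d (z.1, y, z.2) ++ d')) = F y.
  by congr (label_exp _ _ _); apply: funext => d'; rewrite cat_rcons.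
apply => //; first by rewrite addSnnS.
by rewrite addnS -add1n -drop_drop dropD /= drop0.
Qed.

Definition round_inv h o s : Prop :=
  [/\ data_inv h s, size (funsA s) = size h /\ size (funsB s) = size h &
      nmem s 2 = o].

Lemma wp_sampling h o s (V : state -> R) (G : seq triple -> R) :
  bounded_rounds h -> (7 <= o)%N -> (o + m <= N)%N -> round_inv h o s ->
  (forall s' d', sampling_inv h o d' s' -> size d' = m -> G d' <= V s') ->
  wp (sampling_cmd L K eta) s
    (fun s' => exists2 d', sampling_inv h o d' s' & size d' = m)
    (loop_time m + 40) V (label_exp (hyp h) (take m (drop o D)) G).
Proof.
move=> hb o7 oN [[i0 i1 ip il ir] hf c2] GV.
have szt : size (take m (drop o D)) = m by rewrite size_takel // size_drop; lia.
apply: (@wp_weaken _ _ _ _ _ _ _ (fun s' => exists2 d', sampling_inv h o d' s' & size d' = m) _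
  (3 + (6 + (15 + (3 + loop_time m))))) (lexx _) => //; last by lia.
pose st f s' := [/\ nmem s' = f, rmem s' = rmem s, points s' = points s, funsA s' = funsA s & funsB s' = funsB s].
have setN a e f s' ka kv w : st f s' -> neval s' a = ka -> neval s' e = kv ->
    w = (nsize a + nsize e).+1 -> det (SetN a e) s' (st (upd f ka kv)) w.
  by move=> [ef er ep ea eb] ha he hw; apply: det_setN => //; split => //=; rewrite ha he ef.
apply: wp_seq_det.
  by apply: (setN _ _ (nmem s) s 3 0)%N.
move=> s1 h1; have [e1 _ _ _ _] := h1; apply: wp_seq_det.
  by apply: (setN _ _ _ _ 4 (triple_addr D 0) _ h1)%N => //=; rewrite e1; lookup; rewrite i1 /triple_addr; lia.
move=> s2 h2; have [e2 _ _ _ _] := h2; apply: wp_seq_det.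
  by apply: (setN _ _ _ _ 5 (pair_addr E D 0) _ h2)%N => //=; rewrite e2; lookup; rewrite i1 i0 /pair_addr; lia.
move=> s3 h3; have [e3 _ _ _ _] := h3; apply: wp_seq_det.
  by apply: (setN _ _ _ _ 6 (input_addr L K 0) _ h3)%N => //=; rewrite /input_addr; lia.
move=> s4 [e4 r4 p4 a4 b4].
rewrite -[in loop_time m]szt.
apply: (@wp_loop h o _ (drop m (drop o D)) [::]) => //=.
- split; rewrite ?e4 ?a4 ?b4 //.
  + split; rewrite ?e4 ?p4 //; try by lookup.
      by move=> k z k7 Dk; lookup; exact: il.
    by case: ir => hK fl fA fB; split; rewrite ?r4 ?a4 ?b4.
  + by move=> k z; rewrite onth0n.
  + by rewrite addn0; split; lookup.
- by rewrite addn0 cat_take_drop.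
Qed.

(** Extends the oracles from m-tuples to lists, on which the analysis of the learner works; lists of
    other lengths get a default. *)
Definition on_seq (T X : Type) (F : m.-tuple T -> X) (x0 : X) (d : seq T) : X :=
  oapp F x0 (insub d).

Lemma on_seqE (T X : Type) (F : m.-tuple T -> X) x0 (d : m.-tuple T) :
  on_seq F x0 d = F d.
Proof. by rewrite /on_seq valK. Qed.

Definition seq_A : seq triple -> P -> vec R L := on_seq (@or_A _ _ _ E) (fun=> 0).
Definition seq_B : seq (simplex R L * 'I_L * 'I_L) -> simplex R L -> vec R L :=
  on_seq (@or_B _ _ _ E) (fun=> 0).

Lemma onth_tnth (T : Type) k (t : k.-tuple T) (i : 'I_k) :
  onth t i = Some (tnth t i).
Proof.
by rewrite onthE (nth_map (tnth t i)) ?size_tuple // -tnth_nth.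
Qed.

Definition called_inv h o f r s : Prop :=
  [/\ data_inv h s, nmem s 2 = o,
      onth (funsA s) (size h) = Some f, onth (funsB s) (size h) = Some r &
      size (funsA s) = (size h).+1 /\ size (funsB s) = (size h).+1].

Lemma det_call h o d s : sampling_inv h o d s -> size d = m ->
  det (call_cmd R L K) s
    (called_inv h (o + m) (seq_A d) (seq_B (relabel (hyp h) d)))
    (m + m * L + 2 * or_time E + 30).
Proof.
move=> [[i0 i1 ip il [hK fl fA fB]] hs [hA hB] [c2 _ _ _ _]] dm.
have [t tE] : exists t : m.-tuple triple, val t = d.
  by exists (Tuple (introT eqP dm)).
subst d.
pose t' : m.-tuple _ := map_tuple (fun z : triple => (hyp h z.1.1, z.1.2, z.2)) t.
have t'E : relabel (hyp h) t = t' by [].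
rewrite t'E /seq_A /seq_B !on_seqE.
pose s1 := tick (4 + m + or_time E).+1 (push_funA (or_A t) s).
pose s2 := tick (1 + 13 + m * L + or_time E).+1 (push_funB (or_B t') s1).
exists s2; split.
- apply: (@exec_seq _ _ _ _ _ _ _ _ (Ret s1) (fun=> Ret s2)).
    apply: exec_callA => // i.
    have [Di [t1 t2 t3] _ _] := hs i _ (onth_tnth t i).
    rewrite /= i1; split=> //; rewrite t1 ip onth_map Di //.
  move=> s' /= <-; apply: exec_callB => // i.
  have [Di _ [q1 q2] v] := hs i _ (onth_tnth t i).
  rewrite /= i1 i0 tnth_map /=; split => //.
  + by rewrite -q1; congr (nmem s _); rewrite /pair_addr !mulSn !mul0n !addn0.
  + by rewrite -q2; congr (nmem s _); rewrite /pair_addr !mulSn !mul0n !addn0.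
- split => //=; rewrite ?size_rcons ?hA ?hB //.
  + split => //=; split => //= i ih; rewrite onth_rcons ?hA ?hB ih; [exact: fA|exact: fB].
  + by rewrite c2 size_tuple.
  + by rewrite onth_rcons hA ltnn eqxx.
  + by rewrite onth_rcons hB ltnn eqxx.
- by rewrite /=; lia.
Qed.

Lemma take_rcons_onth (T : Type) (s : seq T) j z :
  onth s j = Some z -> take j.+1 s = rcons (take j s) z.
Proof.
by move=> sj; rewrite (take_nth z (onth_size sj)) (onth_nth _ _ _ _ sj).
Qed.

Lemma onth_drop (T : Type) (s : seq T) j k : onth (drop j s) k = onth s (j + k).
Proof. by rewrite !onthE map_drop nth_drop. Qed.

Definition score_time : nat := eval_time + 2 * or_time E + 30 * L + 80.

Lemma det_test h o f r s : bounded_rounds h -> (7 <= o)%N -> (o + M <= N)%N ->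
  called_inv h o f r s ->
  det (test_cmd L K M eta (size h)) s
    (fun s' => [/\ called_inv h (o + M) f r s',
       rmem s' (sum_A L) = \sum_(z <- take M (drop o D)) score (hyp h) f z &
       rmem s' (sum_B L) = \sum_(z <- take M (drop o D)) score (hyp h) (fun x => r (hyp h x)) z])
    (M * score_time + 10).
Proof.
move=> hb o7 oN hs.
pose I j s' := [/\ called_inv h (o + j) f r s',
  rmem s' (sum_A L) = \sum_(z <- take j (drop o D)) score (hyp h) f z &
  rmem s' (sum_B L) = \sum_(z <- take j (drop o D)) score (hyp h) (fun x => r (hyp h x)) z].
(* Testing writes only working cells: the flags begin at real cell 2 L + 3, and the kept labels at
   number cell 9. *)
have data_low h' s' s'' : data_inv h' s' -> nmem s'' 0 = nmem s' 0 -> nmem s'' 1 = nmem s' 1 ->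
    (forall a, (8 < a)%N -> nmem s'' a = nmem s' a) -> points s'' = points s' ->
    funsA s'' = funsA s' -> funsB s'' = funsB s' ->
    (forall a, ((2 * L).+2 < a)%N -> rmem s'' a = rmem s' a) -> data_inv h' s''.
  move=> [i0 i1 ip il [hK fl fA fB]] e0 e1 eN ep ea eb er.
  split; rewrite ?e0 ?e1 ?ep //.
    by move=> k z k7 Dk; rewrite eN ?(il _ z) //; lia.
  split; rewrite ?ea ?eb // => i iK; rewrite er ?fl //; address.
apply: (@det_weaken _ _ _ _ _ _ _ (I M) _ (3 + (3 + (M * score_time).+1))) => //; last by lia.
apply: (det_seq (Q1 := fun s' => called_inv h o f r s' /\ rmem s' (sum_A L) = 0)).
  apply: det_setR => //; split; last exact: upd_same.
  case: hs => hD *; split => //=; apply: data_low hD _ _ _ _ _ _ _ => //= a La.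
  by rewrite upd_other //; address.
move=> s1 [h1 z1]; apply: (det_seq (Q1 := I 0%N)).
  apply: det_setR => //; split; rewrite ?take0 ?big_nil /=; last exact: upd_same.
    rewrite addn0; case: h1 => hD *; split => //=; apply: data_low hD _ _ _ _ _ _ _ => //= a La.
    by rewrite upd_other //; address.
  by rewrite upd_other ?z1 //; address.
move=> s2 h2; apply: det_repeat => // j s' jM [h' zA zB].
have [hD c2 fA fB sz] := h'.
have [z Dz] : exists z, onth D (o + j) = Some z.
  have : (o + j < size D)%N by lia.
  by rewrite -onthTE; case: (onth D (o + j)) => // z _; exists z.
have [_ _ _ il hr] := hD.
have lab : nmem s' (2 + (o + j))%N = z.2 by apply: il => //; lia.
have px : onth (points s') (o + j) = Some z.1 by exact: (points_at hD Dz).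
apply: (@det_weaken _ _ _ _ _ _ _ (I j.+1) _ (eval_time + ((1 + 2 + 1 + L + or_time E).+1 +
  ((6 * L + 15) + ((1 + 1 + 1 + L + or_time E).+1 + ((6 * L + 15) + 6)))))) => //; last first.
  by rewrite /score_time; lia.
apply: (det_seq (det_eval l0 coord E eta_itv hb hr (x := z.1) _)).
  by rewrite c2.
move=> s3 [v3 [n3 p3 a3 b3 r3]].
(* Oracle outputs go to the cells from L on, so one evaluation of the hypothesis serves both
   scores. *)
pose v := hyp h z.1.
pose mid q a s4 := [/\ nmem s4 = nmem s',
  [/\ points s4 = points s', funsA s4 = funsA s' & funsB s4 = funsB s'],
  vec_at s4 0 (pmf v) /\ vec_at s4 L q, rmem s4 (sum_A L) = a &
  forall b, (sum_A L < b)%N -> rmem s4 b = rmem s' b].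
have scoreE q a s4 : mid q a s4 -> reval coord s4 (score_rexp R L) = dotv (pmf v) q - q z.2.
  case=> n4 _ [v4 q4] _ _; rewrite /= (reval_dot coord v4 q4) n4 c2 lab.
  by rewrite q4.
set tA := \sum_(z <- take j (drop o D)) score (hyp h) f z in zA.
apply: (det_seq (Q1 := mid (f z.1) tA)).
  apply: det_evalA => //=; [by rewrite a3; exact: fA|by rewrite n3 c2 p3; exact: px|].
  split => //=.
  - split=> l /=; first by rewrite store_vec_out ?v3 // add0n ltn_ord.
    exact: store_vec_in.
  - by rewrite store_vec_out ?r3 ?zA //; address.
  - by move=> b; rewrite /sum_A => Lb; rewrite store_vec_out ?r3 //; lia.
move=> s4 h4; have sc4 := scoreE _ _ _ h4; case: h4 => n4 [p4 a4 b4] [v4 q4] A4 r4.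
apply: (det_seq (Q1 := mid (f z.1) (tA + (dotv (pmf v) (f z.1) - f z.1 z.2)))).
  apply: det_setR; last by rewrite /= rsize_dot; lia.
  split => //.
  - split=> l; have lL := ltn_ord l.
      by rewrite -(v4 l) [LHS]upd_other //=; address.
    by rewrite -(q4 l) [LHS]upd_other //=; address.
  - by rewrite [LHS]upd_same -sc4 -A4.
  - move=> b; rewrite /sum_A => Lb; rewrite [LHS]upd_other ?r4 //=; address.
move=> s5 [n5 [p5 a5 b5] [v5 q5] A5 r5].
apply: (det_seq (Q1 := mid (r v) (tA + (dotv (pmf v) (f z.1) - f z.1 z.2)))).
  apply: det_evalB => //=; first by rewrite b5; exact: fB.
  split => //=.
  - split=> l /=; first by rewrite store_vec_out ?v5 // add0n ltn_ord.
    exact: store_vec_in.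
  - by rewrite store_vec_out ?A5 //=; address.
  - by move=> b; rewrite /sum_A => Lb; rewrite store_vec_out ?r5 //; rewrite /sum_A; lia.
move=> s6 h6; have sc6 := scoreE _ _ _ h6; case: h6 => n6 [p6 a6 b6] [v6 q6] A6 r6.
apply: (det_seq (Q1 := fun s7 => [/\ nmem s7 = nmem s',
  [/\ points s7 = points s', funsA s7 = funsA s' & funsB s7 = funsB s'],
  rmem s7 (sum_A L) = tA + (dotv (pmf v) (f z.1) - f z.1 z.2),
  rmem s7 (sum_B L) = rmem s' (sum_B L) + (dotv (pmf v) (r v) - r v z.2) &
  forall b, ((2 * L).+2 < b)%N -> rmem s7 b = rmem s' b])).
  apply: det_setR; last by rewrite /= rsize_dot; lia.
  split => //.
  - by rewrite [LHS]upd_other ?A6 //=; address.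
  - by rewrite [LHS]upd_same -sc6 -(r6 (sum_B L)) //=; address.
  - by move=> b Lb; rewrite [LHS]upd_other ?r6 //=; address.
move=> s7 [n7 [p7 a7 b7] A7 B7 r7].
have tk : take j.+1 (drop o D) = rcons (take j (drop o D)) z.
  by apply: take_rcons_onth; rewrite onth_drop.
apply: det_setN => //; split => /=.
- split => //=; rewrite ?a7 ?b7 //.
    apply: (data_low h s') => //=; rewrite ?n7 //.
    by move=> a La; rewrite upd_other //; lia.
  by rewrite upd_same n7 c2 addn1 addnS.
- by rewrite A7 tk -cats1 big_cat big_seq1.
- by rewrite B7 tk -cats1 big_cat big_seq1 zB.
Qed.

End SamplingAndTests.

(** * The rounds of the program realise [success] *)

Section Rounds.
Variables (R : realType) (n L K M : nat) (l0 : 'I_L) (eps : R).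
Hypothesis eps_itv : 0 < eps <= 1.
Local Notation P := (cube n).
Local Notation triple := (P * 'I_L * 'I_L)%type.
Variables (coord : P -> nat -> R) (E : oracles R L P).
Local Notation state := (state R L P).
Local Notation det := (det coord (Some E)).
Local Notation wp := (wp coord (Some E)).
Local Notation m := (or_m E).
Local Notation eta := (rate eps).
Local Notation hyp := (hypothesis_of l0 eta).
Implicit Types (s : state) (h : seq (round R n L)).
Variable D : seq (P * 'I_L).
Local Notation N := (size D).
Local Notation sampling_inv := (sampling_inv K l0 eta E D).
Local Notation data_inv := (data_inv K E D).
Local Notation round_inv := (round_inv K E D).
Hypothesis N7 : (7 <= N)%N.

Definition final_inv h s : Prop :=
  [/\ recorded K h s, bounded_rounds h, nmem s 1 = N & points s = [seq z.1 | z <- D]].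

(** Makes the stored triples a function of the state, which is what a payoff depending on them
    requires. *)
Lemma sampling_inv_inj h o d d' s : sampling_inv h o d s ->
  sampling_inv h o d' s -> size d = size d' -> d = d'.
Proof.
move=> [_ hs _ _] [_ hs' _ _] sz; apply: eq_from_onth_le => i.
rewrite sz maxnn => id'; have id0 : (i < size d)%N by rewrite sz.
move: id' id0; rewrite -!onthTE.
case di : (onth d i) => [z|] //; case di' : (onth d' i) => [z'|] // _ _.
have [Dz [_ t1 _] _ _] := hs i z di; have [Dz' [_ t1' _] _ _] := hs' i z' di'.
congr Some; move: Dz' t1'; rewrite Dz t1.
case: z z' {di di' Dz t1} => [[x y] y1] [[x' y'] y1'] /= [-> ->] /val_inj -> //.
Qed.

Lemma recorded_rcons h e s a : recorded K h s -> (size h < K)%N ->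
  onth (funsA s) (size h) = Some (out_A e) ->
  onth (funsB s) (size h) = Some (out_B e) ->
  a = (if use_A e then 1 else 2) ->
  recorded K (rcons h e) (set_rmem (upd (rmem s) (flag L (size h)) a) s).
Proof.
move=> [hK fl fA fB] lt eA eB ea; split; rewrite ?size_rcons //=.
- move=> i iK; rewrite nth_rcons /upd /flag eqn_add2l ltnS leq_eqVlt.
  case: eqP => [->|ne]; first by rewrite ltnn.
  by rewrite fl //=; case: ifP.
- move=> i; rewrite nth_rcons ltnS leq_eqVlt.
  by case: (ltnP i (size h)) => [ih _|_]; [exact: fA|case: eqP => // ->].
- move=> i; rewrite nth_rcons ltnS leq_eqVlt.
  by case: (ltnP i (size h)) => [ih _|_]; [exact: fB|case: eqP => // ->].
Qed.

Hypothesis A_bounded : forall d x, bounded (@or_A _ _ _ E d x).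
Hypothesis B_bounded : forall d v, bounded (@or_B _ _ _ E d v).

Lemma seq_A_bounded d x : bounded (@seq_A _ _ _ E d x).
Proof.
rewrite /seq_A /on_seq; case: insub => [t|] /=; first exact: A_bounded.
by move=> l; rewrite ffunE; apply/andP; split; lra.
Qed.

Lemma seq_B_bounded d v : bounded (@seq_B _ _ _ E d v).
Proof.
rewrite /seq_B /on_seq; case: insub => [t|] /=; first exact: B_bounded.
by move=> l; rewrite ffunE; apply/andP; split; lra.
Qed.

Definition round_time : nat := loop_time K E m + 40 +
  (m + m * L + 2 * or_time E + 30 + (M * score_time K E + 10)) + 30.

Variable good : seq (round R n L) -> Prop.
Local Notation success := (success l0 eps m M (@seq_A _ _ _ E) (@seq_B _ _ _ E) good).
Local Notation passes := (passes l0 eps M (@seq_A _ _ _ E) (@seq_B _ _ _ E)).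
Local Notation play := (play l0 eps (@seq_A _ _ _ E) (@seq_B _ _ _ E)).

(** The induction mirrors the recursion of [success]: sampling yields its [label_exp], and the two
    conditionals yield its nested case distinction. *)
Lemma wp_rounds j h o s (F : state -> R) :
  (size h + j = K)%N -> bounded_rounds h -> (7 <= o)%N ->
  N = (o + j * (m + M))%N -> round_inv h o s ->
  (forall s' h', final_inv h' s' -> `[< good h' >]%:R <= F s') ->
  wp (rounds_cmd L K M eta (threshold eps M) j) s
    (fun s' => exists h', final_inv h' s') (j * round_time).+1 F
    (success j h (drop o D)).
Proof.
elim: j h o s => [|j IH] h o s hK hb o7 NE hs FV.
  have [[i0 i1 ip il hr] _ _] := hs.
  have fin : final_inv h (tick 1 s) by split.
  apply: (@wp_weaken _ _ _ _ _ _ _ (final_inv h) _ 1) (lexx _) => //.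
  - apply: wp_det; first exact: det_skip.
    by move=> s' hs' /=; exact: (FV s' h hs').
  - by move=> s' hs'; exists h.
have -> : (j.+1 * round_time).+1 = (loop_time K E m + 40 +
  (m + m * L + 2 * or_time E + 30 + (M * score_time K E + 10 + (30 + (j * round_time).+1))))%N.
  by rewrite /round_time mulSn; lia.
have eta_itv := rate_itv eps_itv.
pose D' := take M (drop (m + o) D).
pose X d := if passes h true d D' then success j (rcons h (play h true d)) (drop (o + m + M) D)
    else if passes h false d D' then success j (rcons h (play h false d)) (drop (o + m + M) D)
    else `[< good h >]%:R.
have -> : success j.+1 h (drop o D) = label_exp (hyp h) (take m (drop o D)) X.
  rewrite /=; congr (label_exp _ _ _); apply: funext => d; rewrite /X !drop_drop.
  by rewrite (_ : (m + M + o)%N = (o + m + M)%N) //; lia.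
(* The payoff after sampling recovers the triples from the state by choice; [sampling_inv_inj] shows
   that they are the ones drawn. *)
pose S s' : set (seq triple) := fun d => sampling_inv h o d s' /\ size d = m.
pose V1 s' := X (xget [::] (S s')).
apply: (wp_seq (V1 := V1)).
  apply: (wp_sampling coord eta_itv N7 hb o7 _ hs (G := X)).
    by rewrite NE mulSn; lia.
  move=> s' d hd sd; rewrite /V1.
  have [hx sx] : S s' (xget [::] (S s')) by apply: xgetPex; exists d.
  by rewrite -(sampling_inv_inj hd hx) // sd.
move=> s1 [d hd sd].
have -> : V1 s1 = X d.
  rewrite /V1; have [hx sx] : S s1 (xget [::] (S s1)) by apply: xgetPex; exists d.
  by rewrite -(sampling_inv_inj hd hx) // sd.
have tE : (K - j.+1)%N = size h by rewrite -hK addnK.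
rewrite tE.
apply: (wp_seq_det (det_call coord eta_itv N7 hd sd)) => s2 h2.
have o7' : (7 <= o + m)%N by lia.
have oMN : (o + m + M <= N)%N by rewrite NE mulSn; lia.
apply: (wp_seq_det (det_test l0 coord eta_itv N7 hb o7' oMN h2)) => s3 [h3 A3 B3].
have DE : take M (drop (o + m) D) = D' by rewrite /D' addnC.
rewrite DE in A3 B3.
have hK' : (size h < K)%N by rewrite -hK addnS ltnS leq_addr.
(* Both update branches at once; they differ only in the flag and in the clock. *)
have next b c : onth (funsA s3) (size h) = Some (seq_A E d) -> c = (if b then 1 else 2) ->
    forall s4, nmem s4 = nmem s3 -> rmem s4 = rmem s3 -> points s4 = points s3 ->
    funsA s4 = funsA s3 -> funsB s4 = funsB s3 ->
    wp (Seq (SetR (NLit (flag L (size h))) (RLit c)) (rounds_cmd L K M eta (threshold eps M) j)) s4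
    (fun s' => exists h', final_inv h' s') (3 + (j * round_time).+1) F
    (success j (rcons h (play h b d)) (drop (o + m + M) D)).
  move=> fA cE s4 n4 r4 p4 a4 b4.
  have [[i0 i1 ip il ir] c2 _ fB [szA szB]] := h3.
  apply: (@wp_seq_det _ _ _ _ _ _ _ _ (round_inv (rcons h (play h b d)) (o + m + M))).
    apply: det_setR => //=.
    pose s5 := set_rmem (upd (rmem s3) (flag L (size h)) c) s3.
    have rec5 := recorded_rcons (e := play h b d) ir hK' fA fB cE.
    split => /=; rewrite ?n4 ?a4 ?b4 ?size_rcons //.
    split => /=; rewrite ?n4 ?p4 //.
    by case: rec5 => q1 q2 q3 q4; split; rewrite /= ?r4 ?a4 ?b4.
  move=> s5 h5; apply: IH => //.
  - by rewrite size_rcons addSnnS.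
  - apply: bounded_rounds_rcons => //; split=> [x|v]; [exact: seq_A_bounded|exact: seq_B_bounded].
  - by lia.
  - by rewrite NE mulSn; lia.
have [_ _ fA _ _] := h3.
have passE b : passes h b d D' = (threshold eps M < \sum_(z <- D')
    score (hyp h) (if b then seq_A E d else fun x => seq_B E (relabel (hyp h) d) (hyp h x)) z).
  by case: b.
apply: (@wp_weaken _ _ _ _ _ _ _ (fun s' => exists h', final_inv h' s') _
  (5 + (5 + (3 + (j * round_time).+1)))) (lexx _) => //; last by lia.
apply: wp_if; rewrite /= A3 /X (passE true); case: ifP => _.
  apply: (@wp_weaken _ _ _ _ _ _ _ (fun s' => exists h', final_inv h' s') _
    (3 + (j * round_time).+1)) (lexx _) => //; last by lia.
  exact: next.
apply: wp_if; rewrite /= B3 (passE false); case: ifP => _; first exact: next.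
have [[i0 i1 ip il ir] _ _ _ _] := h3.
have fin : final_inv h (tick 1 (tick 5 (tick 5 s3))) by split.
apply: (@wp_weaken _ _ _ _ _ _ _ (final_inv h) _ 1) (lexx _) => //.
- by apply: wp_det; [exact: det_skip|move=> s' hs'; exact: FV hs'].
- by move=> s' hs'; exists h.
Qed.

End Rounds.

(** * Choice of the constants *)

(* As X >= 3, numerical constants are absorbed by powers of X, and sums cost one
   more factor X. *)
Section PowerBounds.
Variables (R : realType) (X : R).
Hypothesis X3 : 3 <= X.

Lemma X_ge1 : 1 <= X. Proof. by apply: le_trans X3; rewrite ler1n. Qed.

Definition power_bounded (j : nat) (a : R) : Prop := 0 <= a <= X ^+ j.

Lemma power_bounded_const j (c : nat) : (c <= 3 ^ j)%N -> power_bounded j c%:R.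
Proof.
move=> cj; apply/andP; split => //; apply: (@le_trans _ _ ((3 ^ j)%N%:R)); first by rewrite ler_nat.
by rewrite natrX; apply: lerXn2r; rewrite ?nnegrE //; move: (X_ge1); lra.
Qed.

Lemma power_boundedM i j a b :
  power_bounded i a -> power_bounded j b -> power_bounded (i + j) (a * b).
Proof.
move=> /andP[a0 aX] /andP[b0 bX]; apply/andP; split; first exact: mulr_ge0.
by rewrite exprD; exact: ler_pM.
Qed.

Lemma power_bounded_weaken i j a : (i <= j)%N -> power_bounded i a -> power_bounded j a.
Proof.
move=> ij /andP[a0 aX]; apply/andP; split=> //; apply: (le_trans aX).
by apply: ler_weXn2l => //; exact: X_ge1.
Qed.

Lemma power_boundedD i j a b :
  power_bounded i a -> power_bounded j b -> power_bounded (maxn i j).+1 (a + b).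
Proof.
move=> /(power_bounded_weaken (leq_maxl i j)) /andP[a0 aX].
move=> /(power_bounded_weaken (leq_maxr i j)) /andP[b0 bX].
apply/andP; split; first exact: addr_ge0.
rewrite exprS; have x0 := exprn_ge0 (maxn i j) (le_trans ler01 X_ge1).
have : 2 * X ^+ maxn i j <= X * X ^+ maxn i j by apply: ler_wpM2r => //; move: (X3) (X_ge1); lra.
by lra.
Qed.

End PowerBounds.

Section Constants.
Variables (R : realType) (L : nat) (eps delta : R).
Hypotheses (eps_itv : 0 < eps < 1 / 2) (delta_itv : 0 < delta < 1 / 2).

(** More than 32 ln L / eps^2, so the initial potential ln L is below K eps^2 / 32. *)
Definition num_rounds : nat := (Num.truncn (32 * ln L%:R / eps ^+ 2 : R)).+1.
(** With [oracle_confidence] equal to delta / (2 K), the error of a round is delta / (2 K) + 2 delta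
    / (4 K) = delta / K. *)
Definition tail_level : R := delta / (4 * num_rounds%:R).
Definition num_tests : nat := (Num.truncn (512 * ln tail_level^-1 / eps ^+ 2)).+1.
Definition oracle_confidence : R := delta / (2 * num_rounds%:R).

Lemma lnL_ge0 : 0 <= ln L%:R :> R.
Proof. by case: L => [|k]; [rewrite ln0|rewrite ln_ge0 // ler1n]. Qed.

Let e0 : 0 < eps. Proof. by case/andP: eps_itv. Qed.
Let e2 : 0 < eps ^+ 2. Proof. exact: exprn_gt0. Qed.
Let d0 : 0 < delta. Proof. by case/andP: delta_itv. Qed.
Let K0 : 0 < num_rounds%:R :> R. Proof. by rewrite ltr0n. Qed.

Lemma rounds_arg_ge0 : 0 <= 32 * ln L%:R / eps ^+ 2.
Proof. by rewrite divr_ge0 ?(ltW e2) // mulr_ge0 // lnL_ge0. Qed.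

Lemma num_rounds_gt : 32 * ln L%:R / eps ^+ 2 < num_rounds%:R.
Proof. by have /andP[] := truncn_itv rounds_arg_ge0. Qed.

Lemma num_rounds_le : num_rounds%:R <= 32 * ln L%:R / eps ^+ 2 + 1.
Proof.
by have /andP[h _] := truncn_itv rounds_arg_ge0; rewrite /num_rounds -natr1 lerD2r.
Qed.

Lemma tail_level_gt0 : 0 < tail_level.
Proof. by rewrite divr_gt0 // mulr_gt0. Qed.

Lemma tail_level_lnV : 0 <= ln tail_level^-1.
Proof.
rewrite ln_ge0 // invf_ge1 ?tail_level_gt0 // ler_pdivrMr ?mulr_gt0 // mul1r.
have : 1 <= num_rounds%:R :> R by rewrite ler1n.
by case/andP: delta_itv => *; lra.
Qed.

Lemma tests_arg_ge0 : 0 <= 512 * ln tail_level^-1 / eps ^+ 2.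
Proof. by rewrite divr_ge0 ?(ltW e2) // mulr_ge0 // tail_level_lnV. Qed.

Lemma expR_num_tests : expR (- (num_tests%:R * eps ^+ 2 / 512)) <= tail_level.
Proof.
have /andP[_ h] := truncn_itv tests_arg_ge0.
rewrite -[leRHS](@lnK R) ?posrE ?tail_level_gt0 // ler_expR lerNl -lnV ?posrE ?tail_level_gt0 //.
move: (ltW h); rewrite ler_pdivrMr // => h'.
by rewrite ler_pdivlMr // mulrC.
Qed.

Lemma oracle_confidence_gt0 : 0 < oracle_confidence.
Proof. by rewrite divr_gt0 // mulr_gt0. Qed.

Lemma failure_total :
  num_rounds%:R * failure_rate eps num_tests oracle_confidence <= delta.
Proof.
have h := expR_num_tests.
have -> : delta = num_rounds%:R * (oracle_confidence + 2 * tail_level).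
  by rewrite /oracle_confidence /tail_level; field; rewrite lt0r_neq0.
by apply: ler_wpM2l; [exact: ltW|rewrite /failure_rate; lra].
Qed.

(** For L >= 2, ln L >= 1/2 >= eps^2, so the rounding in K is absorbed: K <= 33 ln L / eps^2. This
    gives the constant 1/66, and 1/100 leaves slack. *)
Lemma oracle_confidence_ge :
  1 / 100 * (delta * eps ^+ 2 / ln L%:R) <= oracle_confidence.
Proof.
(* For L <= 1 the logarithm is 0 and so is the quotient by it. *)
case: (ltnP 1 L) => L2; last first.
  have ln_small k : (k <= 1)%N -> ln k%:R = 0 :> R.
    by case: k => [_|[_|]] //; [rewrite ln0|rewrite ln1].
  by rewrite ln_small // invr0 !mulr0 ltW // oracle_confidence_gt0.
have ln2 : 1 / 2 <= ln L%:R :> R.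
  apply: (@le_trans _ _ (ln 2)).
    have h : (0 : R) < 2^-1 by rewrite invr_gt0.
    by have := ln_le_sub1 h; rewrite lnV ?posrE //; lra.
  by rewrite ler_ln ?posrE ?ltr0n ?ler_nat //; lia.
have l0 : 0 < ln L%:R :> R by lra.
have small : 1 <= ln L%:R / eps ^+ 2.
  rewrite ler_pdivlMr // mul1r; apply: le_trans ln2.
  by case/andP: eps_itv => *; rewrite expr2; nra.
have Kle : num_rounds%:R <= 33 * (ln L%:R / eps ^+ 2) by have := num_rounds_le; lra.
rewrite /oracle_confidence ler_pdivlMr ?mulr_gt0 //.
apply: le_trans (_ : 1 / 100 * (delta * eps ^+ 2 / ln L%:R) * (2 * (33 * (ln L%:R / eps ^+ 2))) <= _).
  apply: ler_wpM2l; last by rewrite ler_pM2l.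
  by rewrite mulr_ge0 ?divr_ge0 ?ler01 // ?mulr_ge0 // ltW.
have -> : 1 / 100 * (delta * eps ^+ 2 / ln L%:R) * (2 * (33 * (ln L%:R / eps ^+ 2))) = 66 / 100 * delta.
  by field; rewrite !lt0r_neq0.
by move: d0; lra.
Qed.

Section Sizes.
Variable X : R.
Hypotheses (X3 : 3 <= X) (lX : ln L%:R <= X) (eX : eps^-1 <= X) (dX : ln delta^-1 <= X).
Local Notation pb := (power_bounded X).

Lemma pb_inv_eps2 : pb 2 (eps ^+ 2)^-1.
Proof.
have ei : 0 <= eps^-1 by rewrite invr_ge0 ltW.
rewrite -exprVn; apply/andP; split; first exact: exprn_ge0.
by apply: lerXn2r; rewrite ?nnegrE //; exact: le_trans eX.
Qed.

(** Only ln L, not L, is assumed to be below X, because the number of data points may depend on L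
    only through its logarithm. *)
Lemma pb_num_rounds : pb 9 num_rounds%:R.
Proof.
have /andP[_ h] : pb 9 (32 * ln L%:R / eps ^+ 2 + 1).
  apply: (power_bounded_weaken X3 (i := (maxn (4 + 1 + 2) 0).+1)) => //.
  apply: power_boundedD => //; last exact: (power_bounded_const X3 (c := 1)).
  apply: power_boundedM => //; last exact: pb_inv_eps2.
  apply: power_boundedM => //; first exact: (power_bounded_const X3 (c := 32)).
  by rewrite /power_bounded expr1 lnL_ge0 lX.
by apply/andP; split => //; exact: le_trans num_rounds_le h.
Qed.

(** The inverse of [tail_level] is 4 K / delta, and the crude ln (4 K) <= 4 K is already
    polynomial. *)
Lemma pb_num_tests : pb 26 num_tests%:R.
Proof.
have hln : ln tail_level^-1 <= 4 * num_rounds%:R + ln delta^-1.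
  rewrite /tail_level invf_div mulrC lnM ?posrE ?invr_gt0 ?mulr_gt0 // addrC lerD2r.
  by apply: ltW; apply: ln_sublinear; rewrite mulr_gt0.
have pbl : pb 12 (ln tail_level^-1).
  have /andP[_ h] : pb 12 (4 * num_rounds%:R + ln delta^-1).
    apply: (power_bounded_weaken X3 (i := (maxn (2 + 9) 1).+1)) => //.
    apply: power_boundedD => //.
      apply: power_boundedM => //; first exact: (power_bounded_const X3 (c := 4)).
      exact: pb_num_rounds.
    rewrite /power_bounded expr1 dX andbT ln_ge0 // invf_ge1 //.
    by case/andP: delta_itv => *; lra.
  by apply/andP; split; [exact: tail_level_lnV|exact: le_trans hln h].
have /andP[_ h] : pb 26 (512 * ln tail_level^-1 / eps ^+ 2 + 1).
  apply: (power_bounded_weaken X3 (i := (maxn (6 + 12 + 2) 0).+1)) => //.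
  apply: power_boundedD => //; last exact: (power_bounded_const X3 (c := 1)).
  apply: power_boundedM => //; last exact: pb_inv_eps2.
  by apply: power_boundedM => //; exact: (power_bounded_const X3 (c := 512)).
apply/andP; split => //; apply: le_trans h.
by have /andP[h _] := truncn_itv tests_arg_ge0; rewrite /num_tests -natr1 lerD2r.
Qed.

End Sizes.

End Constants.

Section TimeBounds.
Variables (R : realType) (n L K M : nat) (E : oracles R L (cube n)) (X : R).
Hypothesis X3 : 3 <= X.
Local Notation pb := (power_bounded X).
Hypotheses (pL : pb 1 L%:R) (pm : pb 1 (or_m E)%:R) (pT : pb 1 (or_time E)%:R).
Hypotheses (pK : pb 9 K%:R) (pM : pb 26 M%:R).

Let pbD i j (a b : nat) (pa : pb i a%:R) (pb' : pb j b%:R) :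
  pb (maxn i j).+1 (a + b)%N%:R.
Proof. by rewrite natrD; exact: power_boundedD. Qed.

Let pbM i j (a b : nat) (pa : pb i a%:R) (pb' : pb j b%:R) : pb (i + j) (a * b)%N%:R.
Proof. by rewrite natrM; exact: power_boundedM. Qed.

Let c5 (k : nat) (k_le : (k <= 243)%N) : pb 5 k%:R.
Proof. exact: (power_bounded_const X3 (j := 5)). Qed.

(** The exponents are composed by the rules for sums and products and then rounded up; [isT] checks
    the rounding by computation. *)
Lemma pb_eval_time : pb 20 (eval_time K E)%:R.
Proof.
apply: (power_bounded_weaken X3 _ (pbD (pbD (pbM pK (pbD (pbD (pbM (@c5 21 isT) pL)
  (@c5 40 isT)) pT)) (pbM (@c5 4 isT) pL)) (@c5 10 isT))); exact: isT.
Qed.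

Lemma pb_round_time : pb 60 (round_time K M E)%:R.
Proof.
have ps := pbD (pbD pb_eval_time (pbD (pbM (@c5 30 isT) pL) (@c5 10 isT)))
  (pbD (pbM (@c5 8 isT) pL) (@c5 120 isT)).
have pl := pbD (pbM pm (pbD (@c5 6 isT) ps)) (@c5 6 isT).
have psc := pbD (pbD (pbD pb_eval_time (pbM (@c5 2 isT) pT)) (pbM (@c5 30 isT) pL)) (@c5 80 isT).
apply: (power_bounded_weaken X3 _ (pbD (pbD (pbD pl (@c5 40 isT))
  (pbD (pbD (pbD (pbD pm (pbM pm pL)) (pbM (@c5 2 isT) pT)) (@c5 30 isT))
       (pbD (pbM pM psc) (@c5 10 isT)))) (@c5 30 isT))); exact: isT.
Qed.

Lemma pb_learn_time : pb 80 (3 + (K * round_time K M E).+1)%N%:R.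
Proof.
rewrite -[(K * _).+1]addn1.
apply: (power_bounded_weaken X3 _ (pbD (@c5 3 isT) (pbD (pbM pK pb_round_time) (@c5 1 isT)))).
exact: isT.
Qed.

Lemma pb_apply_time : pb 80 (4 + eval_time K E)%N%:R.
Proof. exact: (power_bounded_weaken X3 _ (pbD (@c5 4 isT) pb_eval_time)). Qed.

Lemma pb_num_data : pb 80 (7 + K * (or_m E + M))%N%:R.
Proof. exact: (power_bounded_weaken X3 _ (pbD (@c5 7 isT) (pbM pK (pbD pm pM)))). Qed.

End TimeBounds.

Lemma power_bounded_poly (R : realType) (a : seq R) (b : R) k :
  power_bounded (1 + \sum_(x <- a) x) k b -> b <= poly_bound 1 k a.
Proof. by rewrite /poly_bound mul1r => /andP[]. Qed.

(** * From the oracle guarantees to the properties of the returned predictor *)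

Section Guarantees.
Variables (R : realType) (n L : nat) (l0 : 'I_L) (mu : dist R (cube n)).
Variables (I : Type) (phi : I -> simplex R L -> R) (grad : I -> simplex R L -> vec R L).
Variables (gs : cube n -> simplex R L) (eps conf : R).
Variable E : oracles R L (cube n).
Local Notation hyp := (hypothesis_of l0 (rate eps)).
Local Notation m := (or_m E).

(* The run must not depend on eps1, so the event whose probability is bounded
   quantifies over eps1. *)
Definition calibrated (s : cube n -> simplex R L) : Prop :=
  forall eps1 : R, 0 < eps1 -> weak_agnostic mu (@or_B _ _ _ E) (range grad) eps1 eps conf ->
  forall i, inner mu (gap s gs) (fun x => grad i (s x)) <= eps1.

Definition good_predictor (s : cube n -> simplex R L) : Prop :=
  indistinguishable mu (@or_A _ _ _ E) eps conf s gs /\ calibrated s.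

Lemma entropy_divergence i s (eps1 : R) :
  inner mu (gap s gs) (fun x => grad i (s x)) <= eps1 ->
  divergence mu (phi i) (grad i) gs s - eps1 <=
    entropy mu (phi i) s - entropy mu (phi i) gs.
Proof.
move=> le1.
have -> : entropy mu (phi i) s - entropy mu (phi i) gs =
  divergence mu (phi i) (grad i) gs s - inner mu (gap s gs) (fun x => grad i (s x)).
  rewrite /entropy /divergence /inner opprK -sumrN -big_split -sumrB /=.
  apply: eq_bigr => x _.
  rewrite /gap !dotvB; ring.
by rewrite lerD2l lerN2.
Qed.

(** A bad predictor is distinguishable, and then the first oracle succeeds, or it violates
    calibration for some admissible eps1, and then the second one does. *)
Lemma oracles_fail_le h : ~ good_predictor (hyp h) ->
  iid_exp (joint2 mu (hyp h) gs) m
    (fun d => (oracles_fail l0 eps (@seq_A _ _ _ E) (@seq_B _ _ _ E) mu gs h d)%:R) <= conf.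
Proof.
move=> bad; set s := hyp h; set p := joint2 mu s gs.
have p0 : forall z, 0 <= p z := joint2_ge0 mu s gs.
have p1 : \sum_z p z = 1 := joint2_sum1 mu s gs.
pose ok b d := (eps < inner mu (gap s gs) (update_of l0 eps (@seq_A _ _ _ E) (@seq_B _ _ _ E) h b d)).
have fail_le b d : (oracles_fail l0 eps (@seq_A _ _ _ E) (@seq_B _ _ _ E) mu gs h d)%:R <= 1 - (ok b d)%:R :> R.
  rewrite /oracles_fail /ok -/s.
  have andb_le (u v w : bool) : w = u \/ w = v -> (u && v)%:R <= 1 - (~~ w)%:R :> R.
    by case: u; case: v => -[] -> /=; rewrite ?subrr ?subr0 ?ler01.
  by rewrite ltNge; apply: andb_le; case: b; [left|right].
(* One successful oracle suffices, as failure requires both to miss. *)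
suff [b okb] : exists b, 1 - conf <= iid_exp p m (fun d => (ok b d)%:R).
  apply: (@le_trans _ _ (1 - iid_exp p m (fun d => (ok b d)%:R))); last by lra.
  rewrite -[X in X - _](iid_exp_const p1 m) -iid_expN -iid_expD.
  by apply: le_iid_exp => // d _; exact: fail_le.
case: (pselect (distinguishable mu (@or_A _ _ _ E) eps conf s gs)) => [dist_s|ind_s].
  exists true; move: dist_s; rewrite /distinguishable (@prob_iidE _ _ _ _ _ (fun d => (ok true d)%:R)) //.
  by move=> d; rewrite /ok /update_of /update_fun /= /seq_A on_seqE asboolb.
have [eps1 [e10 [wa [i gti]]]] : exists eps1 : R, 0 < eps1 /\
   (weak_agnostic mu (@or_B _ _ _ E) (range grad) eps1 eps conf /\
    exists i, eps1 < inner mu (gap s gs) (fun x => grad i (s x))).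
  apply: contrapT => no; apply: bad; split => // eps1 e10 wa i.
  by rewrite leNgt; apply/negP => lt; apply: no; exists eps1; split => //; split => //; exists i.
exists false; have := wa s gs (ex_intro2 _ _ (grad i) (imageT _ _) gti).
rewrite (@prob_iidE _ _ _ _ _ (fun d => (ok false d)%:R)) // => d.
have rE : relabel s d = map_tuple (fun z : cube n * 'I_L * 'I_L => (s z.1.1, z.1.2, z.2)) d by [].
by rewrite /ok /update_of /update_fun /= /seq_B -/s rE on_seqE asboolb.
Qed.

End Guarantees.

Section LearnerCorrect.
Variables (R : realType) (n L K M : nat) (l0 : 'I_L) (eps : R).
Hypothesis eps_itv : 0 < eps <= 1.
Local Notation P := (cube n).
Variables (coord : P -> nat -> R) (E : oracles R L P).
Local Notation m := (or_m E).
Local Notation hyp := (hypothesis_of l0 (rate eps)).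
Local Notation learner := (learner L K M (rate eps) (threshold eps M)).

Lemma evaluates_final (D : seq (P * 'I_L)) h (s : state R L P) (time : R) :
  final_inv K D h s -> (4 + eval_time K E)%N%:R <= time ->
  evaluates coord (Some E) learner s (fun x => pmf (hyp h x)) time.
Proof.
move=> [[hK fl fA fB] hb c1 pts] le_time x.
have [s' [ex v ct]] : det coord (Some E) (apply learner) (present x s)
    (fun s' => vec_at s' 0 (pmf (hyp h x))) (4 + eval_time K E).
  apply: (det_seq (Q1 := fun s1 => recorded K h s1 /\ onth (points s1) (nmem s1 2) = Some x)).
    apply: det_setN => //; split => //=.
    by rewrite upd_same c1 pts onth_rcons size_map ltnn eqxx.
  move=> s1 [rec1 x1].
  apply: det_weaken (det_eval l0 coord E (rate_itv eps_itv) hb rec1 x1) _ _ => //.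
  by move=> s2 [].
exists s'; split => //.
by apply: le_trans le_time; rewrite ler_nat.
Qed.

Hypothesis A_bounded : forall d x, bounded (@or_A _ _ _ E d x).
Hypothesis B_bounded : forall d v, bounded (@or_B _ _ _ E d v).

Lemma wp_learn (good : seq (round R n L) -> Prop) (F : state R L P -> R)
    (data : (7 + K * (m + M)).-tuple (P * 'I_L)) :
  (forall s h, final_inv K data h s -> `[< good h >]%:R <= F s) ->
  wp coord (Some E) (learn learner) (start_on_data R m data)
    (fun s => exists h, final_inv K data h s) (3 + (K * round_time K M E).+1) F
    (success l0 eps m M (@seq_A _ _ _ E) (@seq_B _ _ _ E) good K [::] (drop 7 data)).
Proof.
move=> goodF.
have szD : size data = (7 + K * (m + M))%N by rewrite size_tuple.
apply: (wp_seq_det (Q1 := round_inv K E data [::] 7)).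
  apply: det_setN => //; split => //=.
  split; rewrite /= ?size_tuple //.
    move=> k z k7 Dk; rewrite upd_other; last by lia.
    rewrite add2n /= (nth_map z) ?(onth_size Dk) //.
    by rewrite (onth_nth _ _ _ _ Dk).
move=> s1 h1; apply: (wp_rounds l0 eps_itv coord (E := E) _ A_bounded B_bounded) => //.
by rewrite szD leq_addr.
Qed.

End LearnerCorrect.

(* c, C and k are the absolute constants hidden in Omega and poly.  For L = 1
   the quotient by ln L is 0 by the convention on division by zero, and the
   lower bound on delta' reduces to 0 < delta'. *)
Theorem theorem4p3 (R : realType) :
  exists (c : R) (C k : nat), 0 < c /\
  forall (n L : nat) (mu : dist R (cube n))
         (I : Type) (phi : I -> simplex R L -> R)
         (grad : I -> simplex R L -> vec R L),
    (forall i, convex_on_simplex (phi i)) ->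
    (forall i v, subgradient_at (phi i) v (grad i v)) ->
  forall eps delta : R, 0 < eps < 1 / 2 -> 0 < delta < 1 / 2 ->
  exists (delta' : R) (N : nat -> nat) (S : procedure R),
    [/\ 0 < delta',
        c * (delta * eps ^+ 2 / ln L%:R) <= delta' &
  forall (gstar : cube n -> simplex R L) (m T : nat)
         (A : m.-tuple (cube n * 'I_L * 'I_L) -> cube n -> vec R L)
         (B : m.-tuple (simplex R L * 'I_L * 'I_L) -> simplex R L -> vec R L),
    distinguishing_oracle T A -> calibration_oracle T B ->
    let O := Some (Oracles T A B) in
    let time := poly_bound C k
                  [:: m%:R; T%:R; L%:R; eps^-1; ln delta^-1] in
    let returns (sigma : state R L (cube n)) (s : cube n -> simplex R L) :=
      evaluates (@cube_coord R n) O S sigma (fun x => pmf (s x)) time in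
    (N m)%:R <= poly_bound C k [:: m%:R; ln L%:R; eps^-1; ln delta^-1] /\
    exists run : (N m).-tuple (cube n * 'I_L) -> rand R (state R L (cube n)),
      (forall data,
         exec (@cube_coord R n) O (learn S) (start_on_data R m data) (run data) /\
         on_leaves (run data) (fun sigma =>
           (clock sigma)%:R <= time /\ exists s, returns sigma s)) /\
      forall eps1 : R, 0 < eps1 ->
        weak_agnostic mu B (range grad) eps1 eps delta' ->
        1 - delta <=
          \sum_data iid (joint mu gstar) data *
            rprob (run data) (fun sigma => exists s,
              [/\ returns sigma s,
                  indistinguishable mu A eps delta' s gstar
                & forall i, divergence mu (phi i) (grad i) gstar s - eps1
                            <= entropy mu (phi i) s - entropy mu (phi i) gstar])].
Proof.
(* The multiplicative constant is 1, since numerical factors are absorbed by powers of X >= 3. *)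
exists (1 / 100), 1%N, 80%N; split; first by rewrite divr_gt0.
move=> n L mu I phi grad _ _ eps delta eps_itv delta_itv.
set K := num_rounds L eps; set M := num_tests L eps delta.
set conf := oracle_confidence L eps delta.
exists conf, (fun m => 7 + K * (m + M))%N, (learner L K M (rate eps) (threshold eps M)).
split; [exact: oracle_confidence_gt0|exact: oracle_confidence_ge|].
move=> gs m T A B [A1 _] [B1 _] O time returns.
(* A distribution on labels exists, so L > 0. *)
have [l0 _] : exists l0 : 'I_L, True.
  case: (pickP 'I_L) => [l0 _|none]; first by exists l0.
  have := pmf_sum1 (gs [tuple of nseq n false]); rewrite big_pred0 //.
  by move/esym/eqP; rewrite oner_eq0.
have e1 : 0 < eps <= 1 by case/andP: eps_itv => *; apply/andP; split; lra.
have einv : 2 <= eps^-1.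
  by case/andP: eps_itv => e0 e2; rewrite -[2]invrK lef_pV2 ?posrE ?invr_gt0 //; lra.
have dln : 0 <= ln delta^-1.
  by case/andP: delta_itv => d0 d2; rewrite ln_ge0 // invf_ge1 //; lra.
pose E := Oracles T A B.
have lnL := @lnL_ge0 R L.
have m0 : 0 <= m%:R :> R := ler0n R m.
have T0 : 0 <= T%:R :> R := ler0n R T.
have L0 : 0 <= L%:R :> R := ler0n R L.
split.
  apply: power_bounded_poly; rewrite !big_cons big_nil addr0.
  (* Here X contains ln L but not L; the time bounds below use a larger X with L and T. In both,
     1/eps >= 2 gives X >= 3. *)
  set X := 1 + _.
  have X3 : 3 <= X by rewrite /X; lra.
  apply: (@pb_num_data R n L K M E X X3).
  - by rewrite /power_bounded expr1 m0 /X /=; lra.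
  - by apply: pb_num_rounds => //; rewrite /X; lra.
  - by apply: pb_num_tests => //; rewrite /X; lra.
pose X : R := 1 + \sum_(x <- [:: m%:R; T%:R; L%:R; eps^-1; ln delta^-1]) x.
have XE : X = 1 + (m%:R + (T%:R + (L%:R + (eps^-1 + ln delta^-1)))).
  by rewrite /X !big_cons big_nil addr0.
have X3 : 3 <= X by rewrite XE; lra.
have lL : ln L%:R <= X.
  have : ln L%:R <= L%:R :> R.
    by apply/ltW/ln_sublinear; rewrite ltr0n (leq_trans _ (ltn_ord l0)).
  by rewrite XE; lra.
have pL : power_bounded X 1 L%:R by rewrite /power_bounded expr1 L0 XE; lra.
have pm : power_bounded X 1 (or_m E)%:R by rewrite /power_bounded expr1 m0 XE /=; lra.
have pT : power_bounded X 1 (or_time E)%:R by rewrite /power_bounded expr1 T0 XE /=; lra.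
have pK : power_bounded X 9 K%:R by apply: pb_num_rounds => //; rewrite XE; lra.
have pM : power_bounded X 26 M%:R by apply: pb_num_tests => //; rewrite XE; lra.
have learn_time : (3 + (K * round_time K M E).+1)%N%:R <= time.
  exact: power_bounded_poly (pb_learn_time X3 pL pm pT pK pM).
have apply_time : (4 + eval_time K E)%N%:R <= time.
  exact: power_bounded_poly (pb_apply_time X3 pL pT pK).
have fin_returns data h s : final_inv K data h s -> returns s (hypothesis_of l0 (rate eps) h).
  by move=> fin; exact: (evaluates_final M l0 e1 _ fin).
pose good h := good_predictor mu grad gs eps conf E (hypothesis_of l0 (rate eps) h).
(* This payoff does not mention eps1, so the run can be fixed before eps1 is given. *)
pose F sigma : R := `[< exists s, returns sigma s /\ good_predictor mu grad gs eps conf E s >]%:R.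
have A_bounded d x : bounded (@or_A _ _ _ E d x) by move=> l; exact: A1.
have B_bounded d v : bounded (@or_B _ _ _ E d v) by move=> l; exact: B1.
have goodF data s h : final_inv K data h s -> `[< good h >]%:R <= F s.
  move=> fin; rewrite /F; case: asboolP => // gh; rewrite asboolT //.
  by exists (hypothesis_of l0 (rate eps) h); split => //; exact: fin_returns fin.
have /choice [run runP] (data : (7 + K * (m + M)).-tuple (cube n * 'I_L)) :=
  wp_learn l0 e1 (@cube_coord R n) A_bounded B_bounded (goodF data).
exists run; split => [data|eps1 e10 wa].
  have [ex _ /on_leavesP lf _] := runP data; split => //.
  apply/on_leavesP => s /lf [[h fin] cl]; split.
    by apply: le_trans learn_time; rewrite ler_nat.
  by exists (hypothesis_of l0 (rate eps) h); exact: fin_returns fin.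
pose p := joint mu gs.
have p0 : forall z, 0 <= p z := joint_ge0 mu gs.
have p1 : \sum_z p z = 1 := joint_sum1 mu gs.
pose succ := success l0 eps m M (@seq_A _ _ _ E) (@seq_B _ _ _ E) good K [::].
apply: (@le_trans _ _ (\sum_(data : (7 + K * (m + M)).-tuple _) iid p data * succ (drop 7 data))).
  rewrite (iid_expE p (7 + K * (m + M)) (fun d => succ (drop 7 d))) iid_exp_cat.
  (* The seven sacrificed points integrate out. *)
  rewrite (@eq_iid_exp _ _ p 7 _ (fun=> iid_exp p (K * (m + M)) succ)); last first.
    by move=> d d7; apply: eq_iid_exp => d' _; rewrite drop_size_cat.
  rewrite iid_exp_const //.
  have osucc h : bounded_rounds h -> ~ good h -> iid_exp (joint2 mu (hypothesis_of l0 (rate eps) h) gs) m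
      (fun d => (oracles_fail l0 eps (@seq_A _ _ _ E) (@seq_B _ _ _ E) mu gs h d)%:R) <= conf.
    by move=> _; exact: oracles_fail_le.
  have conf0 : 0 <= conf by apply/ltW; exact: oracle_confidence_gt0.
  apply: le_trans (success_ge e1 M (seq_A_bounded A_bounded) (seq_B_bounded B_bounded) osucc conf0 _ _).
  - by rewrite lerD2l lerN2; exact: failure_total.
  - by move=> i; rewrite ltn0.
  rewrite potential_nil; have := @num_rounds_gt R L eps eps_itv.
  have eps2 : 0 < eps ^+ 2 by rewrite exprn_gt0 //; case/andP: e1.
  by rewrite ltr_pdivrMr // -/K; lra.
apply: ler_sum => data _; apply: ler_wpM2l; first by apply: prodr_ge0 => i _; exact: p0.
have [_ vt _ le_exp] := runP data.
apply: (le_trans le_exp); rewrite rprob_expect; apply: le_expect => // s _.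
(* Only now is calibration instantiated at the given eps1. *)
rewrite /F; case: asboolP => [[g [rg [ind cal]]]|_]; last exact: ler0n.
rewrite asboolT //; exists g; split => // i.
by apply: entropy_divergence; exact: cal.
Qed.
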